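(* Let $n,m\ge 1$, let $A\in\mathbb{R}^{n\times n}$ and let $B\in\mathbb{R}^{n\times m}$ have full column rank. Consider the bilinear control system $$\dot\Phi_t=(A+BK_t)\Phi_t$$ with state $\Phi_t\in \mathrm{GL}^+(n,\mathbb{R})$ and control $K_\cdot$ taking values in $\mathbb{R}^{m\times n}$. The following statements are equivalent: (i) the pair $(A,B)$ satisfies the Kalman rank condition; (ii) the bilinear system is controllable on $\mathrm{GL}^+(n,\mathbb{R})$; (iii) the bilinear system is strongly controllable on $\mathrm{GL}^+(n,\mathbb{R})$.
   Context: $\mathrm{GL}^+(n,\mathbb{R})$ is the group of real $n\times n$ matrices with positive determinant. The pair $(A,B)$ satisfies the Kalman rank condition if $\mathrm{rank}[B, AB,\dots,A^{n-1}B]=n$. The bilinear system is controllable on $\mathrm{GL}^+(n,\mathbb{R})$ if for every $\Phi_{\mathrm{fn}}\in \mathrm{GL}^+(n,\mathbb{R})$ there exist a time $t_{\mathrm{fn}}>0$ and an integrable control $K_\cdot:[0,t_{\mathrm{fn}}]\to\mathbb{R}^{m\times n}$ such that the (absolutely continuous) solution with $\Phi_0=I$ satisfies $\Phi_{t_{\mathrm{fn}}}=\Phi_{\mathrm{fn}}$. It is strongly controllable if for every $t_{\mathrm{fn}}>0$ and every $\Phi_{\mathrm{fn}}\in \mathrm{GL}^+(n,\mathbb{R})$ there exists an integrable control $K_\cdot:[0,t_{\mathrm{fn}}]\to\mathbb{R}^{m\times n}$ such that the solution with $\Phi_0=I$ satisfies $\Phi_{t_{\mathrm{fn}}}=\Phi_{\mathrm{fn}}$.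 *)

(* Defs.v *)
(* MathComp / MathComp-Analysis *)
From HB Require Import structures.
From mathcomp Require Import all_boot all_order all_algebra.
From mathcomp Require Import all_classical all_reals all_analysis.

Set Implicit Arguments.
Unset Strict Implicit.
Unset Printing Implicit Defensive.

Import Order.TTheory GRing.Theory Num.Theory.
Import numFieldNormedType.Exports.

Local Open Scope classical_set_scope.
Local Open Scope ring_scope.

Definition GLplus (R : realType) (n : nat) : set 'M[R]_n :=
  [set X | 0 < \det X].

Definition kalman_matrix (R : realType) (n m : nat)
    (A : 'M[R]_n) (B : 'M[R]_(n, m)) : 'M[R]_(n, \sum_(k < n) m) :=
  \mxrow_(k < n) (A ^+ k *m B).

Definition kalman_rank_condition (R : realType) (n m : nat)
    (A : 'M[R]_n) (B : 'M[R]_(n, m)) : Prop :=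
  \rank (kalman_matrix A B) = n.

(* The intervals ]u i, v i[ may be empty (u i = v i); such indices contribute
   nothing to either sum. *)
Definition absolutely_continuous_on (R : realType) (V : normedModType R)
    (a b : R) (f : R -> V) : Prop :=
  forall e : R, 0 < e -> exists2 d : R, 0 < d &
    forall (N : nat) (u v : 'I_N -> R),
      (forall i, a <= u i /\ u i <= v i /\ v i <= b) ->
      trivIset [set: 'I_N] (fun i => `]u i, v i[%classic) ->
      \sum_(i < N) (v i - u i) < d ->
      \sum_(i < N) `|f (v i) - f (u i)| < e.

(* Controls and trajectories are functions on all of R, of which only the
   restriction to [0, T] matters. *)
Definition integrable_control (R : realType) (n m : nat) (T : R)
    (K : R -> 'M[R]_(m, n)) : Prop :=
  forall i j, (@lebesgue_measure R).-integrable `[0, T]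
    (fun t => (K t i j)%:E).

(* Caratheodory solution on [0, T], in the state space GL+(n, R), of
   Phi' = (A + B K) Phi with Phi 0 = I. *)
Definition bilinear_solution (R : realType) (n m : nat)
    (A : 'M[R]_n) (B : 'M[R]_(n, m)) (T : R)
    (K : R -> 'M[R]_(m, n)) (Phi : R -> 'M[R]_n) : Prop :=
  [/\ Phi 0 = 1%:M,
      forall t, 0 <= t <= T -> GLplus (Phi t),
      absolutely_continuous_on 0 T Phi &
      {ae @lebesgue_measure R, forall t : R, 0 < t < T ->
        is_derive t (1 : R) Phi ((A + B *m K t) *m Phi t)}].

Definition steerable_in_time (R : realType) (n m : nat)
    (A : 'M[R]_n) (B : 'M[R]_(n, m)) (T : R) (X : 'M[R]_n) : Prop :=
  exists K : R -> 'M[R]_(m, n), integrable_control T K /\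
    exists Phi : R -> 'M[R]_n, bilinear_solution A B T K Phi /\ Phi T = X.

Definition controllable (R : realType) (n m : nat)
    (A : 'M[R]_n) (B : 'M[R]_(n, m)) : Prop :=
  forall X : 'M[R]_n, GLplus X ->
    exists T : R, 0 < T /\ steerable_in_time A B T X.

Definition strongly_controllable (R : realType) (n m : nat)
    (A : 'M[R]_n) (B : 'M[R]_(n, m)) : Prop :=
  forall T : R, 0 < T ->
  forall X : 'M[R]_n, GLplus X -> steerable_in_time A B T X.

(* Main.v *)
(* With U = K Phi the state equation becomes Phi' = A Phi + B U, so a control is
   the same thing as a path in GL+ whose defect Phi' - A Phi has columns in the
   image of B; a flat output parametrizes the polynomial paths of this kind.
   Let Gamma be the set of limits of points reachable in arbitrarily small time.
   It is a semigroup, and it contains I + v w (1 + w v > 0) for v in the image of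
   B, by large controls acting for a short time.  The vectors v with this property
   for all w form a subspace, which is stable under A: dilating strongly along v
   magnifies the drift into a one-sided shear along A v, and a product of shears
   rotates v to A v.  Under the Kalman condition Gamma therefore contains all
   rank-one updates of I, which generate GL+.  Hence every point of GL+ is a limit
   of points reachable in any prescribed time; as polynomial endpoints form an open
   set, every point is reached exactly.
   Conversely, if N is the left kernel of the Kalman matrix, then N B = 0 and
   N A = C N, so N Phi satisfies a linear equation and the row space of N is
   preserved by every Phi_T, which fails for a suitable shear. *)
Require Import Defs.
From HB Require Import structures.
From mathcomp Require Import all_boot all_order all_algebra.
From mathcomp Require Import all_classical all_reals all_analysis.
From mathcomp Require Import measurable_realfun.
From mathcomp Require Import lra ring zify.

Set Implicit Arguments.
Unset Strict Implicit.
Unset Printing Implicit Defensive.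

Import Order.TTheory GRing.Theory Num.Theory.
Import numFieldNormedType.Exports.

Local Open Scope classical_set_scope.
Local Open Scope ring_scope.

Local Notation constmx := (map_mx polyC).
Local Notation evalmx s := (map_mx (horner_eval s)).

(** * Generation of GL+ by rank-one updates of the identity *)

(** The two sides are the Schur complements of one block matrix with identity diagonal blocks,
    factored triangularly in two ways. *)
Lemma det_rank1_update (F : fieldType) (n : nat) (v : 'cV[F]_n) (w : 'rV[F]_n) :
  \det (1%:M + v *m w) = 1 + (w *m v) 0 0.
Proof.
have E : block_mx 1%:M (- w) v 1%:M = block_mx 1%:M 0 v 1%:M *m
    block_mx 1%:M (- w) 0 (1%:M + v *m w).
  by rewrite mulmx_block !mul1mx !mulmx0 !mul0mx !addr0 mulmx1 mulmxN addrC addrK.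
have E' : block_mx 1%:M (- w) v 1%:M = block_mx 1%:M (- w) 0 1%:M *m
    block_mx (1%:M + w *m v) 0 v 1%:M.
  rewrite mulmx_block !mul1mx !mulmx0 !mul0mx !add0r mulmx1 mulNmx.
  by rewrite addrK.
have := congr1 determinant E; rewrite E' !det_mulmx !det_ublock !det_lblock.
by rewrite !det1 !mul1r !mulr1 => <-; rewrite det_mx11 !mxE.
Qed.

Lemma rV_mul_eq1 (F : fieldType) (n : nat) (v : 'cV[F]_n) :
  v != 0 -> exists w : 'rV[F]_n, w *m v = 1%:M.
Proof.
move=> /matrix0Pn[i [j vij]]; exists ((v i j)^-1 *: delta_mx 0 i).
apply/matrixP => a b; rewrite -scalemxAl -rowE !mxE !ord1.
by rewrite (ord1 j) in vij *; rewrite mulVf.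
Qed.

(** Off the line of [u], some column of [cokermx u^T], a functional killing [u], is nonzero on [v];
    it is rescaled to take the value 1. *)
Lemma separating_rV (F : fieldType) (n : nat) (v u : 'cV[F]_n) :
  (forall c, v != c *: u) ->
  exists w : 'rV[F]_n, w *m v = 1%:M /\ w *m u = 0.
Proof.
move=> vu; have : ~~ (v^T <= u^T)%MS.
  apply/negP => /submxP[D E]; have := vu (D 0 0).
  have -> : v = D 0 0 *: u.
    apply: trmx_inj; rewrite E {1}[D]mx11_scalar mul_scalar_mx.
    by apply/matrixP => a b; rewrite !mxE.
  by rewrite eqxx.
rewrite submxE => /matrix0Pn[i [j E]].
pose c := (v^T *m cokermx u^T) i j.
have cE : (col j (cokermx u^T))^T *m v = c%:M.
  rewrite -[v]trmxK -trmx_mul [LHS]mx11_scalar; congr (_%:M).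
  by rewrite colE mulmxA -colE !mxE /c -(ord1 i) !mxE.
exists (c^-1 *: (col j (cokermx u^T))^T); rewrite -!scalemxAl cE; split.
  by rewrite scale_scalar_mx mulVf.
apply: trmx_inj; rewrite linearZ /= trmx_mul trmxK colE mulmxA mulmx_coker.
by rewrite mul0mx scaler0 trmx0.
Qed.

Section Transvections.
Variables (F : realFieldType) (n : nat) (G : 'M[F]_n -> Prop).
Hypothesis GM : forall X Y, G X -> G Y -> G (X *m Y).

(** The condition on [w] says that the update has positive determinant, by [det_rank1_update]. *)
Definition all_rank1_updates (v : 'cV[F]_n) : Prop :=
  forall w : 'rV[F]_n, 0 < 1 + (w *m v) 0 0 -> G (1%:M + v *m w).

(** Since [G] is only a semigroup, the inverse [h] of [g] has to be supplied as a member of it. *)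
Lemma rank1_updates_conj (g h : 'M[F]_n) (v : 'cV[F]_n) :
  G g -> G h -> g *m h = 1%:M ->
  all_rank1_updates v -> all_rank1_updates (g *m v).
Proof.
move=> Gg Gh gh Pv w; rewrite mulmxA => wv.
have -> : 1%:M + g *m v *m w = g *m (1%:M + v *m (w *m g)) *m h.
  by rewrite mulmxDr mulmxDl mulmx1 gh !mulmxA -[_ *m g *m h]mulmxA gh mulmx1.
by apply: GM => //; apply: GM => //; exact: Pv.
Qed.

Lemma rank1_updatesZ (a : F) (v : 'cV[F]_n) :
  all_rank1_updates v -> all_rank1_updates (a *: v).
Proof.
by move=> Pv w; rewrite -scalemxAr -scalemxAl scalemxAl scalemxAr; exact: Pv.
Qed.

(** For independent vectors, a shear along [u] carries [v] to [v + u]. Its inverse is again an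
    update along [u], so conjugation applies. *)
Lemma rank1_updatesD (v u : 'cV[F]_n) :
  all_rank1_updates v -> all_rank1_updates u -> all_rank1_updates (v + u).
Proof.
move=> Pv Pu.
have [/existsNP[c /negP/negPn/eqP->]|/contrapT vu] :=
    pselect (~ forall c, v != c *: u).
  by rewrite -[X in _ + X]scale1r -scalerDl; exact: rank1_updatesZ.
have [w [wv wu]] := separating_rV vu.
have -> : v + u = (1%:M + u *m w) *m v.
  by rewrite mulmxDl mul1mx -mulmxA wv mulmx1.
apply: (@rank1_updates_conj _ (1%:M + u *m - w)) => //.
- by apply: Pu; rewrite wu mxE addr0.
- by apply: Pu; rewrite mulNmx wu !mxE oppr0 addr0.
- rewrite mulmxDl mul1mx !mulmxDr mulmx1 mulmxA -(mulmxA u) wu mulmx0 mul0mx.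
  by rewrite addr0 mulmxN subrK.
Qed.

(* The three shears compose to the rotation [v -> u -> - v] of the plane spanned
   by [v] and [u]; it has order 4, so its inverse also lies in the semigroup [G]. *)
Lemma rank1_updates_rotate (v u : 'cV[F]_n) (w w' : 'rV[F]_n) :
  w *m v = 1%:M -> w *m u = 0 -> w' *m v = 0 -> w' *m u = 1%:M ->
  G (1%:M + u *m w) -> all_rank1_updates v -> all_rank1_updates u.
Proof.
move=> wv wu w'v w'u Guw Pv.
pose V := row_mx v u; pose W := col_mx w w'.
have WV : W *m V = 1%:M.
  by rewrite mul_col_row wv wu w'v w'u -scalar_mx_block.
(* [phi N] acts as [N] on the plane of [v] and [u] and trivially on the kernel of [W]; it is
   multiplicative because [W *m V = 1%:M]. The rest is computed with 2 by 2 matrices. *)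
pose phi (N : 'M[F]_(1 + 1)) := 1%:M + V *m (N - 1%:M) *m W.
have phiM N N' : phi N *m phi N' = phi (N *m N').
  rewrite /phi.
  have -> : N *m N' - 1%:M = (N - 1%:M) + (N' - 1%:M) + (N - 1%:M) *m (N' - 1%:M).
    rewrite mulmxBl mul1mx mulmxBr mulmx1 -addrA; apply/subr0_eq.
    rewrite [N' - _ + _]addrC subrK.
    by rewrite [N - _ + _]addrC addrA subrK subrr.
  have VW a b : V *m a *m W *m (V *m b *m W) = V *m (a *m b) *m W.
    by rewrite -!mulmxA (mulmxA W) WV mul1mx.
  move: (N - 1%:M) (N' - 1%:M) => a b.
  rewrite mulmxDl mul1mx mulmxDr mulmx1 VW !mulmxDr !mulmxDl -!addrA.
  by congr (_ + _); rewrite addrCA.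
pose K a b c d : 'M[F]_(1 + 1) := block_mx a%:M b%:M c%:M d%:M.
have phiK a b c d : phi (K a b c d) =
    1%:M + (((a - 1) *: v + c *: u) *m w + (b *: v + (d - 1) *: u) *m w').
  rewrite /phi /K (@scalar_mx_block _ 1 1) opp_block_mx add_block_mx !subr0.
  have scB (x : F) : x%:M - 1%:M = (x - 1)%:M :> 'M[F]_1 by rewrite -raddfB.
  by rewrite mul_row_block !scB !mul_mx_scalar mul_row_col.
have KM a b c d a' b' c' d' : K a b c d *m K a' b' c' d' =
    K (a * a' + b * c') (a * b' + b * d') (c * a' + d * c') (c * b' + d * d').
  by rewrite /K mulmx_block -!scalar_mxM -!raddfD.
have GS : G (phi (K 1 (- 1) 0 1)).
  rewrite phiK subrr !scale0r !addr0 mul0mx add0r scaleN1r mulNmx -mulmxN.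
  by apply: Pv; rewrite mulNmx w'v !mxE oppr0 addr0.
have GL : G (phi (K 1 0 1 1)).
  by rewrite phiK subrr !scale0r scale1r addr0 add0r mul0mx addr0.
pose J := K 0 (- 1) 1 0.
have JE : J = K 1 (- 1) 0 1 *m K 1 0 1 1 *m K 1 (- 1) 0 1.
  by rewrite !KM /J; congr K; ring.
have GJ : G (phi J) by rewrite JE -!phiM; apply: GM => //; exact: GM.
have J4 : J *m (J *m J *m J) = 1%:M.
  have -> : 1%:M = K 1 0 0 1 by rewrite (@scalar_mx_block _ 1 1) /K raddf0.
  by rewrite !KM; congr K; ring.
have -> : u = phi J *m v.
  rewrite phiK !mulmxDl mul1mx -!mulmxA wv w'v !mulmx0 !mulmx1.
  by rewrite scale1r sub0r scaleN1r !addr0 addrA subrr add0r.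
apply: (@rank1_updates_conj _ (phi (J *m J *m J))) => //.
  by rewrite -!phiM; apply: GM => //; exact: GM.
by rewrite phiM J4 /phi subrr mulmx0 mul0mx addr0.
Qed.

Lemma rank1_updates_sum (I : Type) (r : seq I) (P : pred I) (v : I -> 'cV[F]_n) :
  G 1%:M -> (forall i, P i -> all_rank1_updates (v i)) ->
  all_rank1_updates (\sum_(i <- r | P i) v i).
Proof.
move=> G1 Pv; apply: (big_ind all_rank1_updates) => //.
  by move=> w _; rewrite mul0mx addr0.
exact: rank1_updatesD.
Qed.

End Transvections.

(** The update [1 + (y - e) w] with [w e = 1] sends [e] to [y] and has determinant [w y], so it
    suffices to find [w] with [w y > 0]. This fails only when the first column of [X] is a negative
    multiple of [e], which is then reached through an intermediate vector. *)
Lemma rank1_update_transitive (F : realFieldType) (n : nat)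
    (G : 'M[F]_(1 + n) -> Prop) :
  (forall X Y, G X -> G Y -> G (X *m Y)) ->
  (forall v, all_rank1_updates G v) ->
  forall X : 'M[F]_(1 + n), 0 < \det X ->
  exists g, [/\ G g, 0 < \det g & lsubmx X = g *m col_mx 1%:M 0].
Proof.
move=> GM Gr X dX; set x := lsubmx X.
pose e : 'cV[F]_(1 + n) := col_mx 1%:M 0.
have step y (w : 'rV_(1 + n)) : w *m e = 1%:M -> 0 < (w *m y) 0 0 ->
    exists g, [/\ G g, 0 < \det g & y = g *m e].
  move=> we wy; exists (1%:M + (y - e) *m w).
  have pos : 0 < 1 + (w *m (y - e)) 0 0.
    rewrite mulmxBr we; move: (w *m y) wy => q qpos.
    by rewrite !mxE mulr1n addrCA subrr addr0.
  split; [exact: Gr|by rewrite det_rank1_update|].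
  by rewrite mulmxDl mul1mx -mulmxA we mulmx1 addrC subrK.
have eqw (w1 : 'rV_n) : row_mx 1%:M w1 *m e = 1%:M.
  by rewrite mul_row_col mulmx0 addr0 mulmx1.
have stepd (y : 'cV_(1 + n)) : dsubmx y != 0 ->
    exists g, [/\ G g, 0 < \det g & y = g *m e].
  move=> /rV_mul_eq1[w1 w1y].
  apply: (step y (row_mx 1%:M ((1 - usubmx y 0 0) *: w1))) => //.
  rewrite -[y in _ *m y]vsubmxK mul_row_col mul1mx -scalemxAl w1y.
  move: (usubmx y) => q.
  by rewrite !mxE mulr1n mulr1 addrCA subrr addr0 ltr01.
have [xd|] := eqVneq (dsubmx x) 0; last exact: stepd.
pose c := usubmx x 0 0.
have xE : x = col_mx c%:M 0.
  by rewrite -[LHS]vsubmxK xd; congr col_mx; rewrite [LHS]mx11_scalar.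
have [c_gt0|c_le0] := ltP 0 c.
  apply: (step x (row_mx 1%:M 0)) => //.
  by rewrite xE mul_row_col mul1mx mul0mx addr0 mxE mulr1n.
have c_neq0 : c != 0.
  apply/eqP => c0; have Xe : X *m e = 0.
    by rewrite -[X]hsubmxK mul_row_col mulmx0 addr0 mulmx1 -/x xE c0 raddf0 col_mx0.
  have uX : X \in unitmx by rewrite unitmxE unitfE gt_eqF.
  have : e = 0 by rewrite -(mulKmx uX e) Xe mulmx0.
  move/(congr1 (fun z : 'cV[F]_(1 + n) => z (lshift n 0) 0)); rewrite col_mxEu !mxE.
  by move/eqP; rewrite mulr1n oner_eq0.
(* In dimension one [c] is the determinant, hence positive. In higher dimension there is room for a
   detour through [y], which has nonzero lower part, followed by a shear from [y] to [x]. *)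
case: n => [|n] in G GM Gr X dX x e step eqw stepd c xd xE c_le0 c_neq0 *.
  have /negP[] : ~~ (0 < c) by rewrite -leNgt.
  have -> : c = X 0 0 by rewrite /c /x !mxE; congr (X _ _); apply/val_inj.
  by rewrite -(@det_mx11 F X).
pose y : 'cV[F]_(1 + n.+1) := col_mx c%:M (const_mx 1).
have yd : dsubmx y != 0.
  rewrite col_mxKd; apply/eqP => /(congr1 (fun z : 'cV_n.+1 => z 0 0)).
  by rewrite !mxE => /eqP; rewrite oner_eq0.
have [g [Gg dg yE]] := stepd y yd.
pose v : 'cV[F]_(1 + n.+1) := col_mx 0 (- c^-1 *: const_mx 1).
pose w : 'rV[F]_(1 + n.+1) := row_mx 1%:M 0.
have wv : w *m v = 0 by rewrite mul_row_col mulmx0 mul0mx addr0.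
have pos : 0 < 1 + (w *m v) 0 0 by rewrite wv mxE addr0.
exists ((1%:M + v *m w) *m g); split.
- by apply: GM => //; exact: Gr.
- by rewrite det_mulmx det_rank1_update mulr_gt0.
- rewrite -mulmxA -yE mulmxDl mul1mx -mulmxA mul_row_col mul1mx mul0mx addr0.
  rewrite mul_col_mx mul0mx mul_mx_scalar scalerA mulrN divff //.
  by rewrite add_col_mx addr0 scaleN1r subrr.
Qed.

(** Induction on the dimension. Dividing by an element of [G] with the same first column leaves a
    block upper triangular matrix, which is a lower block of positive determinant times one update
    along the first basis vector. *)
Lemma GLplus_rank1_generated (F : realFieldType) (n : nat) (G : 'M[F]_n -> Prop) :
  (forall X Y, G X -> G Y -> G (X *m Y)) ->
  (forall v, all_rank1_updates G v) ->
  forall X, 0 < \det X -> G X.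
Proof.
elim: n => [|n IH] in G *; move=> GM Gr X dX.
  have -> : X = 1%:M + (0 : 'cV_0) *m (0 : 'rV_0) by apply/matrixP => -[].
  by apply: Gr; rewrite mulmx0 mxE addr0.
have GMb : forall U U' : 'M[F]_(1 + n), G U -> G U' -> G (U *m U') := GM.
have Grb : forall (v : 'cV[F]_(1 + n)) (w : 'rV_(1 + n)),
  0 < 1 + (w *m v) 0 0 -> G (1%:M + v *m w) := Gr.
have [g [Gg dg gE]] := @rank1_update_transitive F n G GM Gr X dX.
have ug : g \in unitmx by rewrite unitmxE unitfE gt_eqF.
pose Z : 'M[F]_(1 + n) := invmx g *m X.
have XE : X = g *m Z by rewrite mulKVmx.
have Zl : lsubmx Z = col_mx 1%:M 0.
  have h (M : 'M[F]_(1 + n)) : lsubmx M = M *m col_mx 1%:M 0.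
    by rewrite -[M in RHS]hsubmxK mul_row_col mulmx0 addr0 mulmx1.
  by rewrite h -mulmxA -h gE mulKmx.
pose r := ursubmx Z; pose Y := drsubmx Z.
have ZE : Z = block_mx 1%:M r 0 Y.
  have := Zl; rewrite -[in X in X -> _](submxK Z) block_mxEh row_mxKl.
  by move=> /eq_col_mx[E1 E2]; rewrite -[LHS]submxK E1 E2.
have dY : 0 < \det Y.
  by move: dX; rewrite XE det_mulmx ZE (det_ublock _ r Y) det1 mul1r pmulr_rgt0.
pose G' (U : 'M[F]_n) := G (block_mx (1%:M : 'M[F]_1) 0 0 U).
have G'Y : G' Y.
  apply: (IH G') => //.
    move=> U U' GU GU'; have := GMb _ _ GU GU'.
    by rewrite mulmx_block !(mulmx1, mul1mx, mulmx0, mul0mx, addr0, add0r).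
  move=> v w wv; have := Grb (col_mx 0 v) (row_mx 0 w).
  rewrite mul_row_col mul0mx add0r => /(_ wv).
  rewrite mul_col_row !mul0mx !mulmx0 (@scalar_mx_block _ 1 n) add_block_mx.
  by rewrite !addr0.
suff GZ : G Z by have := GMb _ _ Gg GZ; rewrite -XE.
have -> : Z = block_mx (1%:M : 'M[F]_1) 0 0 Y *m
    (1%:M + (col_mx 1%:M 0 : 'cV[F]_(1 + n)) *m row_mx 0 r).
  rewrite mul_col_row !mul0mx !mulmx0 mul1mx (@scalar_mx_block _ 1 n) add_block_mx.
  by rewrite mulmx_block !(mulmx1, mul1mx, mulmx0, mul0mx, addr0, add0r).
apply: GMb => //; apply: Grb.
by rewrite mul_row_col mul0mx mulmx0 addr0 mxE addr0.
Qed.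

(** * Polynomial trajectories *)

Section FlatTrajectories.
Variables (R : realType) (n m : nat) (A : 'M[R]_n) (B : 'M[R]_(n, m)).

(** The [p] columns are trajectories of the linear system run in parallel. For [p = n] and [X]
    invertible, [U X^-1] is a control of the bilinear system. *)
Definition poly_trajectory (p : nat) (X : 'M[{poly R}]_(n, p))
    (U : 'M[{poly R}]_(m, p)) : Prop :=
  map_mx (@deriv R) X = constmx A *m X + constmx B *m U.

Lemma poly_trajectoryD p (X Y : 'M[{poly R}]_(n, p)) U V :
  poly_trajectory X U -> poly_trajectory Y V -> poly_trajectory (X + Y) (U + V).
Proof.
rewrite /poly_trajectory => XU YV.
by rewrite map_mxD XU YV !mulmxDr addrACA.
Qed.

Lemma poly_trajectoryMr p q (X : 'M[{poly R}]_(n, p)) U (Z : 'M[R]_(p, q)) :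
  poly_trajectory X U -> poly_trajectory (X *m constmx Z) (U *m constmx Z).
Proof.
rewrite /poly_trajectory => XU; rewrite !mulmxA -mulmxDl -XU.
apply/matrixP => i j; rewrite !mxE raddf_sum; apply: eq_bigr => k _.
by rewrite !mxE /= derivM derivC mulr0 addr0.
Qed.

Lemma horner_eval_mxC p q (s : R) (Z : 'M[R]_(p, q)) : evalmx s (constmx Z) = Z.
Proof. by apply/matrixP => i j; rewrite !mxE /horner_eval hornerC. Qed.

(* The coefficients [g_k] of the parametrization
   [x = adj (d/dt - A) B p], [u = char_poly_A (d/dt) p]
   of the trajectories by a flat output [p]. *)
Fixpoint flat_coef (p : {poly R}) (k : nat) : {poly R} :=
  if k is k'.+1 then
    (flat_coef p k')^`() + (char_poly A)`_(n.-1 - k') *: p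
  else p.

Definition flat_state (p : {poly R}) : 'M[{poly R}]_(n, m) :=
  \sum_(k < n) flat_coef p k *: constmx (A ^+ (n.-1 - k) *m B).

Definition flat_control (p : {poly R}) : 'M[{poly R}]_m := (flat_coef p n)%:M.

(** Cayley-Hamilton, with the lower terms listed from the highest degree down, the order in which
    [flat_coef] uses the coefficients. *)
Lemma sum_char_poly_mx : (0 < n)%N ->
  A ^+ n + \sum_(k < n) (char_poly A)`_(n.-1 - k) *: A ^+ (n.-1 - k) = 0.
Proof.
move=> n_gt0; rewrite (reindex_inj rev_ord_inj) /=.
under eq_bigr => k _.
  rewrite (_ : (n.-1 - (n - k.+1))%N = k); last by case: k => k /=; lia.
  over.
move: A n_gt0; case: n => // k M _; have := Cayley_Hamilton M.
rewrite -[in X in X -> _](coefK (char_poly M)) poly_def raddf_sum size_char_poly.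
rewrite big_ord_recr /= => E; rewrite -[RHS]E addrC.
congr (_ + _); last first.
  by under [RHS]eq_bigr => i _ do rewrite horner_mxZ rmorphXn /= horner_mx_X.
rewrite horner_mxZ rmorphXn /= horner_mx_X.
have /monicP := char_poly_monic M.
by rewrite /lead_coef size_char_poly => ->; rewrite scale1r.
Qed.

Lemma flat_state_trajectory (p : {poly R}) :
  (0 < n)%N -> poly_trajectory (flat_state p) (flat_control p).
Proof.
move=> n_gt0.
pose M k : 'M[R]_(n, m) := A ^+ (n.-1 - k) *m B.
pose S K := \sum_(k < K) flat_coef p k *: constmx (M k).
(* The recursion of [flat_coef] makes the derivatives telescope. What remains is the next
   coefficient and [p] times a truncated characteristic polynomial of [A], which vanishes at
   [K = n]. *)
have dS K : (K <= n)%N -> map_mx (@deriv R) (S K) = constmx A *m S K +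
    (flat_coef p K *: constmx (A ^+ (n - K) *m B) -
     p *: constmx ((A ^+ n + \sum_(k < K) (char_poly A)`_(n.-1 - k) *: A ^+ (n.-1 - k))
        *m B)).
  elim: K => [_|K IH Kn].
    by rewrite /S !big_ord0 map_mx0 mulmx0 addr0 subn0 subrr addr0.
  have -> : S K.+1 = S K + flat_coef p K *: constmx (M K) by rewrite /S big_ord_recr.
  rewrite map_mxD IH 1?ltnW // mulmxDr -!addrA; congr (_ + _).
  have -> : map_mx (@deriv R) (flat_coef p K *: constmx (M K)) =
      (flat_coef p K)^`() *: constmx (M K).
    by apply/matrixP => i j; rewrite !mxE derivM derivC mulr0 addr0.
  have -> : constmx A *m (flat_coef p K *: constmx (M K)) =
      flat_coef p K *: constmx (A ^+ (n - K) *m B).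
    rewrite (_ : n - K = (n.-1 - K).+1)%N; last by lia.
    by rewrite -scalemxAr -map_mxM mulmxA exprS.
  congr (_ + _).
  rewrite big_ord_recr /= addrA [in RHS]mulmxDl map_mxD scalerDr opprD.
  rewrite [RHS]addrCA; congr (_ + _).
  have -> : (n - K.+1 = n.-1 - K)%N by lia.
  rewrite -/(M K) scalerDl -addrA [X in _ = _ + X](_ : _ = 0) ?addr0 //.
  by rewrite -scalemxAl -/(M K) map_mxZ -!mul_polyC scalerA mulrC subrr.
rewrite /poly_trajectory {1}/flat_state dS // sum_char_poly_mx // mul0mx map_mx0.
rewrite scaler0 subr0 subnn expr0 mul1mx; congr (_ + _).
by rewrite /flat_control mul_mx_scalar.
Qed.
(** Each step of the recursion lowers the order of vanishing at [s] by exactly one: the derivative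
    contributes a nonzero integer multiple of the cofactor, and the added term vanishes to higher
    order. *)
Lemma flat_coef_factor (s : R) (j : nat) (r : {poly R}) (k : nat) : (k <= j)%N ->
  exists2 q : {poly R},
    flat_coef (('X - s%:P) ^+ j * r) k = ('X - s%:P) ^+ (j - k) * q &
    r.[s] != 0 -> q.[s] != 0.
Proof.
elim: k => [_|k IH kj]; first by exists r => //; rewrite subn0.
have [q qE q_neq0] := IH (ltnW kj).
have [d djk] : exists d, (j - k = d.+1)%N by exists (j - k).-1; lia.
have -> : (j - k.+1 = d)%N by lia.
have jE : (j = d + k.+1)%N by lia.
exists (q *+ d.+1 + ('X - s%:P) * q^`() +
    (char_poly A)`_(n.-1 - k) *: (('X - s%:P) ^+ k.+1 * r)).
  rewrite /= qE djk jE derivM deriv_exp derivXsubC mul1r /= exprD -!mul_polyC.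
  by rewrite !exprS -[q *+ _]mulr_natr -[_ ^+ d *+ _]mulr_natr; ring.
move=> /q_neq0 qs; rewrite !hornerD hornerMn !(hornerM, hornerZ).
rewrite horner_exp hornerXsubC subrr exprS !mul0r mulr0 !addr0.
by rewrite -mulr_natr mulf_neq0 // pnatr_eq0.
Qed.

(** With flat output [(X - s)^j X^N], the coefficients vanish at [s] below index [j] but not at [j],
    so the values at [s] form a triangular system in the [A ^+ i *m B]. The factor [X^N] makes the
    state vanish at 0. The condition on [s ^+ N] covers both [N = 0] with [s = 0] (initial data) and
    [s] nonzero (data at a later time). *)
Lemma poly_trajectory_through (p N : nat) (s : R) (x0 : 'M[R]_(n, p))
    (u0 : 'M[R]_(m, p)) :
  (0 < n)%N -> kalman_rank_condition A B -> s ^+ N != 0 ->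
  exists (X : 'M[{poly R}]_(n, p)) (U : 'M[{poly R}]_(m, p)),
    [/\ poly_trajectory X U, evalmx s X = x0, evalmx s U = u0 &
        (n <= N)%N -> evalmx 0 X = 0].
Proof.
move=> n_gt0 kal sN.
pose attained x u := exists (X : 'M[{poly R}]_(n, p)) (U : 'M[{poly R}]_(m, p)),
    [/\ poly_trajectory X U, evalmx s X = x, evalmx s U = u &
        (n <= N)%N -> evalmx 0 X = 0].
have attD x u y v : attained x u -> attained y v -> attained (x + y) (u + v).
  move=> [X [U [XU <- <- X0]]] [Y [V [YV <- <- Y0]]].
  exists (X + Y), (U + V); split.
  - exact: poly_trajectoryD.
  - by rewrite map_mxD.
  - by rewrite map_mxD.
  - by move=> nN; rewrite map_mxD X0 // Y0 // addr0.
have flat_att j : (j <= n)%N ->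
    exists2 c : nat -> R, (forall k, (k < j)%N -> c k = 0) /\ c j != 0 &
      forall Z : 'M[R]_(m, p),
        attained (\sum_(k < n) c k *: (A ^+ (n.-1 - k) *m B *m Z)) (c n *: Z).
  move=> jn; pose f := ('X - s%:P) ^+ j * 'X^N.
  exists (fun k => (flat_coef f k).[s]); [split|].
  - move=> k kj; have [q -> _] := flat_coef_factor s 'X^N (ltnW kj).
    by rewrite hornerM horner_exp hornerXsubC subrr expr0n subn_eq0 leqNgt kj mul0r.
  - have [q -> qs] := flat_coef_factor s 'X^N (leqnn j).
    by rewrite subnn expr0 mul1r qs // hornerXn.
  move=> Z; exists (flat_state f *m constmx Z), (flat_control f *m constmx Z).
  have evalZ q (s' : R) a (M : 'M[R]_(a, m)) :
      evalmx s' (q *: constmx M) = q.[s'] *: M.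
    by apply/matrixP => i k; rewrite !mxE /horner_eval hornerM hornerC.
  have evalS s' : evalmx s' (flat_state f) =
      \sum_(k < n) (flat_coef f k).[s'] *: (A ^+ (n.-1 - k) *m B).
    by rewrite /flat_state raddf_sum; apply: eq_bigr => k _; exact: evalZ.
  split.
  - exact/poly_trajectoryMr/flat_state_trajectory.
  - rewrite map_mxM horner_eval_mxC evalS mulmx_suml.
    by apply: eq_bigr => k _; rewrite -scalemxAl.
  - rewrite map_mxM horner_eval_mxC /flat_control -scalemx1 -(map_mx1 polyC).
    by rewrite evalZ -scalemxAl mul1mx.
  - move=> nN; rewrite map_mxM evalS big1 ?mul0mx // => k _.
    have kN : (k < N)%N by rewrite (leq_trans _ nN).
    have := flat_coef_factor 0 (('X - s%:P) ^+ j) (ltnW kN).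
    rewrite subr0 mulrC => -[q -> _].
    by rewrite hornerM hornerXn expr0n subn_eq0 leqNgt kN mul0r scale0r.
(* For [j = n] all state coefficients vanish at [s] and only the control survives. *)
have att_u u : attained 0 u.
  have [c [c0 cn] att] := flat_att n (leqnn n).
  have := att ((c n)^-1 *: u); rewrite scalerA divff // scale1r big1 // => k _.
  by rewrite c0 // scale0r.
(* For [j = n.-1 - i] the first surviving term is the one with [A ^+ i]. The later ones have smaller
   powers and are removed by induction, the control by [att_u]. *)
have att_powers i (Z : 'M[R]_(m, p)) : (i < n)%N -> attained (A ^+ i *m B *m Z) 0.
  elim/ltn_ind: i Z => i IH Z in_.
  have jn : (n.-1 - i < n)%N by lia.
  have [c [c0 cj] att] := flat_att (n.-1 - i)%N (ltnW jn).
  pose Z' := (c (n.-1 - i)%N)^-1 *: Z.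
  have := att Z'; rewrite (bigD1 (Ordinal jn)) //= {1}/Z' -scalemxAr scalerA.
  rewrite divff // scale1r (_ : n.-1 - (n.-1 - i) = i)%N; last by lia.
  set y := \sum_(k < n | _) _ => att_y.
  have attNy : attained (- y) 0.
    rewrite /y -sumrN; apply: (big_ind (attained^~ 0)) => //.
      by move=> a b atta attb; rewrite -[0]addr0; exact: attD.
    move=> k kj; have {}kj : (k != n.-1 - i :> nat)%N.
      by apply: contraNneq kj => kE; apply/eqP/val_inj.
    have [ki|ik] := ltnP k (n.-1 - i).
      by rewrite c0 // scale0r oppr0.
    have := IH (n.-1 - k)%N _ (- c k *: Z'); rewrite -scalemxAr scaleNr.
    by apply; have := ltn_ord k; lia.
  have := attD _ _ _ _ att_y attNy; rewrite addrK addr0 => att_i.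
  by have := attD _ _ _ _ att_i (att_u (- (c n *: Z'))); rewrite addr0 subrr.
suff att_x : attained x0 0.
  by have := attD _ _ _ _ att_x (att_u u0); rewrite addr0 add0r.
have /row_freeP[Y KY] : row_free (kalman_matrix A B) by rewrite /row_free kal.
have -> : x0 = \sum_(i < n) A ^+ i *m B *m (submxcol Y i *m x0).
  rewrite -[LHS]mul1mx -KY -[in LHS](submxcolK Y) mul_mxrow_mxcol mulmx_suml.
  by apply: eq_bigr => i _; rewrite !mulmxA.
apply: (big_ind (attained^~ 0)) => //.
  by move=> a b atta attb; rewrite -[0]addr0; exact: attD.
by move=> i _; exact: att_powers.
Qed.

End FlatTrajectories.

(** * Limits of reachable points in small time *)

Section MatrixLimits.
Variables (R : realType) (T : Type) (F : set_system T).
Context {FF : Filter F}.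

Lemma cvg_mxP (m n : nat) (f : T -> 'M[R]_(m, n)) (L : 'M[R]_(m, n)) :
  (forall i j, f x i j @[x --> F] --> L i j) <-> f x @[x --> F] --> L.
Proof.
split=> [fL|fL i j].
  move=> N [P LP sPN]; have FP : \forall x \near F, forall i j, P i j (f x i j).
    by apply: filter_forall => i; apply: filter_forall => j; exact: fL.
  by apply: filterS FP => x Px; exact: sPN.
by apply: (cvg_comp f (fun M : 'M[R]_(m, n) => M i j) fL); exact: coord_continuous.
Qed.

Lemma cvg_mulmx (m n p : nat) (f : T -> 'M[R]_(m, n)) (g : T -> 'M[R]_(n, p))
    (L : 'M[R]_(m, n)) (M : 'M[R]_(n, p)) :
  f x @[x --> F] --> L -> g x @[x --> F] --> M ->
  f x *m g x @[x --> F] --> L *m M.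
Proof.
move=> /cvg_mxP fL /cvg_mxP gM; apply/cvg_mxP => i j; rewrite mxE.
under eq_fun do rewrite mxE.
apply: cvg_big => //; first exact: add_continuous.
by move=> k _; apply: cvgM.
Qed.

Lemma cvg_det (n : nat) (f : T -> 'M[R]_n) (L : 'M[R]_n) :
  f x @[x --> F] --> L -> \det (f x) @[x --> F] --> \det L.
Proof.
move=> /cvg_mxP fL; apply: cvg_big => //; first exact: add_continuous.
move=> s _; apply: cvgM; first exact: cvg_cst.
apply: cvg_big => //; exact: mul_continuous.
Qed.

Lemma cvg_evalmx (m n : nat) (X : 'M[{poly R}]_(m, n)) (s : T -> R) (a : R) :
  s x @[x --> F] --> a -> evalmx (s x) X @[x --> F] --> evalmx a X.
Proof.
move=> sa; apply/cvg_mxP => i j; rewrite mxE; under eq_fun do rewrite mxE.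
by apply: (cvg_comp s _ sa); exact: continuous_horner.
Qed.

End MatrixLimits.

Section SmallTimeClosure.
Variables (R : realType) (n m : nat) (A : 'M[R]_n) (B : 'M[R]_(n, m)).
Hypotheses (n_gt0 : (0 < n)%N) (kalAB : kalman_rank_condition A B).

Definition poly_reachable (T : R) (Y : 'M[R]_n) : Prop :=
  exists (X : 'M[{poly R}]_n) (U : 'M[{poly R}]_(m, n)),
    [/\ poly_trajectory A B X U, evalmx 0 X = 1%:M, evalmx T X = Y &
        forall t, 0 <= t <= T -> 0 < \det (evalmx t X)].

(** Finite concatenations of polynomial arcs. The system is right invariant, so an arc ending at [Y]
    continues a path from [Z] to [Y *m Z]: the right factor comes first in time. *)
Inductive reachable : R -> 'M[R]_n -> Prop :=
| reachable_poly T Y : 0 < T -> poly_reachable T Y -> reachable T Y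
| reachable_step S T Y Z : 0 < S -> poly_reachable S Y -> reachable T Z ->
    reachable (S + T) (Y *m Z).

Lemma reachableM S T Y Z :
  reachable S Y -> reachable T Z -> reachable (S + T) (Y *m Z).
Proof.
move=> SY; elim: SY Z => {S Y} [S Y S_gt0 SY Z TZ|S S' Y Y' S_gt0 SY _ IH Z TZ].
  exact: reachable_step.
by rewrite -addrA -mulmxA; apply: reachable_step => //; exact: IH.
Qed.

Lemma reachable_gt0 T Y : reachable T Y -> 0 < T.
Proof. by elim=> // S T' Z Z' S_gt0 _ _; exact: addr_gt0. Qed.

Lemma reachable_det_gt0 T Y : reachable T Y -> 0 < \det Y.
Proof.
have pos S Z : 0 < S -> poly_reachable S Z -> 0 < \det Z.
  by move=> S_gt0 [X [U [_ _ <-]]]; apply; rewrite lexx ltW.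
elim=> [S Z|S T' Z Z' S_gt0 SZ _ Z'_gt0]; first exact: pos.
by rewrite det_mulmx mulr_gt0 // (pos S).
Qed.

(** A trajectory [D] with [D(0) = 0] and [D(T) = 1] corrects the endpoint linearly. Compactness of
    the time interval keeps the determinant positive under small corrections. *)
Lemma near_poly_reachable T Y : 0 < T -> poly_reachable T Y ->
  \forall Y' \near Y, poly_reachable T Y'.
Proof.
move=> T_gt0 [X [U [XU X0 XT Xpos]]].
have [|D [V [DV D_T _ D0]]] :=
    @poly_trajectory_through R n m A B n n T 1%:M 0 n_gt0 kalAB _.
  by rewrite expf_neq0 // gt_eqF.
pose W Y' := X + D *m constmx (Y' - Y).
have WE t Y' : evalmx t (W Y') = evalmx t X + evalmx t D *m (Y' - Y).
  by rewrite /W map_mxD map_mxM horner_eval_mxC.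
suff : \forall Y' \near Y, `[0, T] `<=` [set t | 0 < \det (evalmx t (W Y'))].
  apply: filterS => Y' Wpos; exists (W Y'), (U + V *m constmx (Y' - Y)); split.
  - by apply: poly_trajectoryD => //; exact: poly_trajectoryMr.
  - by rewrite WE X0 D0 // mul0mx addr0.
  - by rewrite WE XT D_T mul1mx addrC subrK.
  - by move=> t tT; apply: Wpos; rewrite /= in_itv.
have /compact_near_coveringP/(_ _ (nbhs Y)) := @segment_compact R 0 T.
apply=> t /= tT.
have : \det (evalmx p.1 X + evalmx p.1 D *m (p.2 - Y)) @[p --> (t, Y)] -->
    \det (evalmx t X + evalmx t D *m (Y - Y)).
  apply: cvg_det; apply: cvgD; first exact: cvg_evalmx cvg_fst.
  apply: cvg_mulmx; first exact: cvg_evalmx cvg_fst.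
  by apply: cvgB; [exact: cvg_snd|exact: cvg_cst].
rewrite subrr mulmx0 addr0 => /cvgrPdist_lt.
have Xt : 0 < \det (evalmx t X) by apply: Xpos; move: tT; rewrite in_itv.
move=> /(_ _ Xt); apply: filterS => -[t' Y'] /= close; rewrite WE.
move: close; rewrite ltr_distl; lra.
Qed.

Definition reachable_before (T : R) : set 'M[R]_n :=
  [set Y | exists2 t, t < T & reachable t Y].

Definition small_time_limit (Y : 'M[R]_n) : Prop :=
  forall T, 0 < T -> closure (reachable_before T) Y.

Lemma closure_reachable_beforeM S T Y Z :
  closure (reachable_before S) Y -> closure (reachable_before T) Z ->
  closure (reachable_before (S + T)) (Y *m Z).
Proof.
move=> SY TZ N YZN.
have YZ : (p.1 *m p.2 : 'M[R]_n) @[p --> (Y, Z)] --> Y *m Z.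
  by apply: cvg_mulmx; [exact: cvg_fst|exact: cvg_snd].
have [[P Q] /= [PY QZ] PQN] := YZ _ YZN.
have [Y' [[s sS sY'] PY']] := SY _ PY; have [Z' [[t tT tZ'] QZ']] := TZ _ QZ.
exists (Y' *m Z'); split; last exact: (PQN (Y', Z')).
by exists (s + t); [exact: ltrD|exact: reachableM].
Qed.

Lemma small_time_limitM Y Z :
  small_time_limit Y -> small_time_limit Z -> small_time_limit (Y *m Z).
Proof.
move=> SY SZ T T_gt0; rewrite (splitr T).
by apply: closure_reachable_beforeM; [apply: SY|apply: SZ]; rewrite divr_gt0.
Qed.

Lemma small_time_limit_cvg (f : R -> 'M[R]_n) Y :
  (forall T, 0 < T -> \forall t \near 0^'+, closure (reachable_before T) (f t)) ->
  f t @[t --> 0^'+] --> Y -> small_time_limit Y.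
Proof.
move=> fT fY T T_gt0.
exact: (closed_cvg (closure (reachable_before T)) (@closed_closure _ _) (fT T T_gt0)).
Qed.
End SmallTimeClosure.

(** * Rank-one updates as small-time limits *)

Section SmallTimeRank1.
Variables (R : realType) (n m : nat) (A : 'M[R]_n) (B : 'M[R]_(n, m)).
Hypotheses (n_gt0 : (0 < n)%N) (kalAB : kalman_rank_condition A B).

Local Notation Gamma := (small_time_limit A B).

(** The difference quotient at 0 is itself a polynomial, so its limit in short time is an
    evaluation. *)
Lemma poly_quotientX (p q : nat) (X : 'M[{poly R}]_(p, q)) :
  exists2 X1, X = constmx (evalmx 0 X) + 'X *: X1 &
    evalmx 0 X1 = evalmx 0 (map_mx (@deriv R) X).
Proof.
pose X1 := map_mx (drop_poly 1) X.
have XE : X = constmx (evalmx 0 X) + 'X *: X1.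
  apply/matrixP => i j; rewrite !mxE -[LHS](poly_take_drop 1).
  by rewrite expr1 [_ * 'X]mulrC /horner_eval horner_coef0 /take_poly
    (poly_def 1) big_ord1 expr0 alg_polyC.
exists X1 => //; rewrite [in RHS]XE; apply/matrixP => i j; rewrite !mxE.
rewrite derivD derivC add0r derivM derivX mul1r /horner_eval hornerD hornerM hornerX.
by rewrite mul0r addr0.
Qed.

(** A trajectory [H] with zero state and control [k *m w] at time 0 is amplified by [e^-1] and run
    for time [e]. In the rescaled time [t] the path tends to [1 + t B k w], whose determinant is
    affine in [t] and positive on [[0, 1]]; compactness transfers this to small [e]. *)
Lemma small_time_limit_input (k : 'cV[R]_m) : all_rank1_updates Gamma (B *m k).
Proof.
move=> w wBk.
have [|Y [U [YU Y0 _ _]]] :=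
  @poly_trajectory_through R n m A B n 0 0 1%:M 0 n_gt0 kalAB _.
  by rewrite expr0 oner_neq0.
have [|H [V [HV H0 V0 _]]] :=
  @poly_trajectory_through R n m A B n 0 0 0 (k *m w) n_gt0 kalAB _.
  by rewrite expr0 oner_neq0.
have [H1 HE H10] := poly_quotientX H.
rewrite H0 map_mx0 add0r in HE.
have {}H10 : evalmx 0 H1 = B *m k *m w.
  by rewrite H10 HV map_mxD !map_mxM !horner_eval_mxC H0 V0 mulmx0 add0r mulmxA.
pose path (e t : R) := evalmx (e * t) Y + t *: evalmx (e * t) H1.
have path0 t : path 0 t = 1%:M + B *m k *m (t *: w).
  by rewrite /path mul0r Y0 H10 -scalemxAr.
have near_path t : (path p.2 p.1) @[p --> (t, 0 : R)] --> path 0 t.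
  have st : p.2 * p.1 @[p --> (t, 0 : R)] --> 0 * t.
    by apply: cvgM; [exact: cvg_snd|exact: cvg_fst].
  apply: cvgD; first exact: cvg_evalmx st.
  by apply: cvgZ; [exact: cvg_fst|exact: cvg_evalmx st].
have path_pos : \forall e \near 0^'+, `[0, 1] `<=` [set t | 0 < \det (path e t)].
  apply: cvg_within.
  have /compact_near_coveringP/(_ _ (nbhs (0 : R))) := @segment_compact R 0 1.
  apply=> t /= /itvP t01.
  have : \det (path p.2 p.1) @[p --> (t, 0 : R)] --> \det (path 0 t).
    exact: cvg_det (near_path t).
  rewrite path0 => /cvgrPdist_lt.
  set d := \det _; have d_gt0 : 0 < d.
    rewrite /d det_rank1_update -scalemxAl mxE.
    have [t1 t0] : t <= 1 /\ 0 <= t by rewrite !t01.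
    have tz := mulr_ge0 t0 (ltW wBk); move: t1; rewrite le_eqVlt => /predU1P[->|t1].
      by rewrite mul1r.
    by move: tz; rewrite mulrDr mulr1; lra.
  move=> /(_ _ d_gt0); apply: filterS => -[t' e] /=; rewrite ltr_distl; lra.
apply: (@small_time_limit_cvg _ _ _ A B (path^~ 1)); last first.
  rewrite -[X in _ + _ *m X]scale1r -path0; apply: cvg_at_right_filter.
  have e1 : (e * 1 : R) @[e --> (0 : R)] --> (0 * 1 : R).
    by apply: cvgM; [exact: cvg_id|exact: cvg_cst].
  apply: cvgD; first exact: cvg_evalmx e1.
  by apply: cvgZ; [exact: cvg_cst|exact: cvg_evalmx e1].
move=> T T_gt0; near=> e; apply: subset_closure; exists e => //.
have e_gt0 : 0 < e by [].
have pathE t : evalmx (e * t) (Y + e^-1%:P *: H) = path e t.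
  rewrite map_mxD [in X in _ + X]HE scalerA; congr (_ + _).
  apply/matrixP => i j; rewrite !mxE /= /horner_eval !(hornerM, hornerC, hornerX).
  by rewrite mulrA mulVf ?mul1r // gt_eqF.
apply: reachable_poly => //.
exists (Y + e^-1%:P *: H), (U + e^-1%:P *: V); split.
- apply: poly_trajectoryD => //; move: HV; rewrite /poly_trajectory => HV.
  rewrite -!scalemxAr -scalerDr -HV; apply/matrixP => i j.
  by rewrite !mxE derivM derivC mul0r add0r.
- by rewrite -[X in evalmx X](mulr0 e) pathE /path mulr0 Y0 scale0r addr0.
- by rewrite -[X in evalmx X](mulr1 e) pathE.
- move=> t t0e; rewrite -[t](mulVKf (lt0r_neq0 e_gt0)) pathE.
  have : `[0, 1] `<=` [set t | 0 < \det (path e t)] by near: e.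
  apply; rewrite /= in_itv /= mulrC; move: t0e => /andP[t0 te].
  by rewrite divr_ge0 ?(ltW e_gt0) //= ler_pdivrMr // mul1r.
Unshelve. all: by end_near.
Qed.

Lemma near_initial_reachable (Y : 'M[{poly R}]_n) (U : 'M[{poly R}]_(m, n)) :
  poly_trajectory A B Y U -> evalmx 0 Y = 1%:M ->
  \forall t \near 0^'+, poly_reachable A B t (evalmx t Y).
Proof.
move=> YU Y0.
have : \det (evalmx t Y) @[t --> (0 : R)] --> \det (evalmx 0 Y).
  by apply: cvg_det; apply: cvg_evalmx; exact: cvg_id.
rewrite Y0 det1 => /cvgrPdist_lt/(_ _ ltr01)[d /= d_gt0 dP].
near=> t; exists Y, U; split=> // s /andP[s_ge0 st].
have : ball 0 d s.
  by rewrite /ball /= sub0r normrN ger0_norm // (le_lt_trans st).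
by move=> /dP /=; rewrite ltr_distl; lra.
Unshelve. all: by end_near. Qed.

(** Let [w v = 1] and let [u] be the part of [A v] killed by [w]. The drift yields the single shear
    [1 + u w], enough for [rank1_updates_rotate] to pass from [v] to [u]; then [A v] is [u] plus a
    multiple of [v]. *)
Lemma small_time_limit_shift (v : 'cV[R]_n) :
  all_rank1_updates Gamma v -> all_rank1_updates Gamma (A *m v).
Proof.
move=> Gv; have [->|v_neq0] := eqVneq v 0.
  rewrite mulmx0; by have := @small_time_limit_input 0; rewrite mulmx0.
have [w wv] := rV_mul_eq1 v_neq0.
have [|Y [U [YU Y0 U0 _]]] :=
  @poly_trajectory_through R n m A B n 0 0 1%:M 0 n_gt0 kalAB _.
  by rewrite expr0 oner_neq0.
have [Y1 YE Y10] := poly_quotientX Y.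
rewrite Y0 map_mx1 in YE.
rewrite YU map_mxD !map_mxM !horner_eval_mxC Y0 U0 mulmx0 addr0 mulmx1 in Y10.
pose u := (1%:M - v *m w) *m (A *m v).
have wu : w *m u = 0.
  by rewrite /u mulmxA mulmxBr mulmx1 (mulmxA w v) wv mul1mx subrr mul0mx.
(* Conjugating the short-time trajectory [Y] by a dilation of ratio [1 + t^-1]
   along [v] magnifies the displacement [t A] to order one. *)
have Guw : Gamma (1%:M + u *m w).
  pose f t := 1%:M +
    (1%:M - (1 + t)^-1 *: (v *m w)) *m evalmx t Y1 *m (t *: 1%:M + v *m w).
  apply: (@small_time_limit_cvg _ _ _ A B f); last first.
    have -> : u *m w = (1%:M - (1 + 0)^-1 *: (v *m w)) *m evalmx 0 Y1 *m
        (0 *: 1%:M + v *m w).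
      by rewrite addr0 invr1 !scale1r scale0r add0r Y10 /u !mulmxA.
    apply: cvg_at_right_filter; apply: cvgD; first exact: cvg_cst.
    apply: cvg_mulmx; first apply: cvg_mulmx.
    - apply: cvgB; first exact: cvg_cst.
      apply: cvgZ; last exact: cvg_cst.
      apply: cvgV; first by rewrite addr0 oner_neq0.
      by apply: cvgD; [exact: cvg_cst|exact: cvg_id].
    - by apply: cvg_evalmx; exact: cvg_id.
    - apply: cvgD; last exact: cvg_cst.
      by apply: cvgZ; [exact: cvg_id|exact: cvg_cst].
  move=> T T_gt0; near=> t.
  have t_gt0 : 0 < t by [].
  (* The outer factors are mutually inverse. Writing [Y = 1 + t Y1] at time [t], the factor [t] is
     absorbed by the unbounded dilation, leaving [t + v w], which converges. *)
  have -> : f t = (1%:M + v *m (- (1 + t)^-1 *: w)) *m evalmx t Y *m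
      (1%:M + v *m (t^-1 *: w)).
    have Yt : evalmx t Y = 1%:M + t *: evalmx t Y1.
      rewrite [in LHS]YE map_mxD -(map_mx1 polyC) horner_eval_mxC; congr (_ + _).
      by apply/matrixP => i j; rewrite !mxE /= /horner_eval hornerM hornerX.
    set L := 1%:M + v *m (_ *: w); set L' := 1%:M + v *m (_ *: w).
    have LL' : L *m L' = 1%:M.
      rewrite mulmxDl mul1mx mulmxDr mulmx1 -addrA -[RHS]addr0; congr (_ + _).
      rewrite -!scalemxAr -scalemxAl (mulmxA (v *m w)) -(mulmxA v) wv mulmx1.
      rewrite scalerA -!scalerDl [X in X *: _](_ : _ = 0) ?scale0r //.
      by field; rewrite !gt_eqF ?addr_gt0.
    have tL' : t *: L' = t *: 1%:M + v *m w.
      by rewrite scalerDr -scalemxAr scalerA divff ?scale1r // gt_eqF.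
    rewrite Yt mulmxDr mulmx1 mulmxDl LL' -scalemxAr -scalemxAl scalemxAr tL'.
    by rewrite /L -scalemxAr scaleNr.
  have -> : T = T / 2 / 2 + T / 2 + T / 2 / 2 by field.
  apply: closure_reachable_beforeM; last first.
    apply: Gv; last by rewrite !divr_gt0.
    by rewrite -scalemxAl wv !mxE mulr1n mulr1 addr_gt0 ?invr_gt0.
  apply: closure_reachable_beforeM.
    apply: Gv; last by rewrite !divr_gt0.
    rewrite -scalemxAl wv !mxE mulr1n mulr1 subr_gt0 invf_lt1 ?addr_gt0 //.
    by rewrite ltrDl.
  apply: subset_closure; exists t.
    by near: t; apply: nbhs_right_lt; rewrite divr_gt0.
  by apply: reachable_poly => //; near: t; exact: near_initial_reachable YU Y0.
have Gu : all_rank1_updates Gamma u.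
  have [/existsNP[c /negP/negPn/eqP->]|/contrapT uv] :=
      pselect (~ forall c, u != c *: v).
    exact: rank1_updatesZ.
  have [w' [w'u w'v]] := separating_rV uv.
  by apply: (rank1_updates_rotate (@small_time_limitM _ _ _ A B) wv wu w'v w'u).
have -> : A *m v = u + (w *m (A *m v)) 0 0 *: v.
  rewrite /u mulmxBl mul1mx -mulmxA [X in v *m X]mx11_scalar mul_mx_scalar.
  by rewrite subrK.
apply: rank1_updatesD => //; first exact: small_time_limitM.
exact: rank1_updatesZ.
Unshelve. all: by end_near.
Qed.

Lemma small_time_limit_GLplus (X : 'M[R]_n) : 0 < \det X -> Gamma X.
Proof.
apply: GLplus_rank1_generated; first exact: small_time_limitM.
move=> v; have /row_freeP[Y KY] : row_free (kalman_matrix A B).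
  by rewrite /row_free kalAB.
have -> : v = \sum_(i < n) A ^+ i *m (B *m (submxcol Y i *m v)).
  rewrite -[LHS]mul1mx -KY -[in LHS](submxcolK Y) mul_mxrow_mxcol mulmx_suml.
  by apply: eq_bigr => i _; rewrite !mulmxA.
apply: rank1_updates_sum; first exact: small_time_limitM.
  have := @small_time_limit_input 0 0; rewrite !mulmx0 addr0; apply.
  by rewrite mxE addr0.
move=> i _; elim: (i : nat) => [|k IH].
  by rewrite expr0 mul1mx; exact: small_time_limit_input.
by rewrite exprS -mulmxA; exact: small_time_limit_shift.
Qed.

End SmallTimeRank1.

(** The quotient by the determinant replaces [invmx], which branches on invertibility, by an
    expression continuous in the entries. *)
Lemma cvg_invmx (R : realType) (T : Type) (F : set_system T) {FF : Filter F}
    (n : nat) (f : T -> 'M[R]_n) (L : 'M[R]_n) :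
  f x @[x --> F] --> L -> \det L != 0 ->
  (\det (f x))^-1 *: \adj (f x) @[x --> F] --> invmx L.
Proof.
move=> fL dL; rewrite /invmx unitmxE unitfE dL.
apply: cvgZ; first by apply: cvgV => //; exact: cvg_det.
apply/cvg_mxP => i j; rewrite mxE; under eq_fun do rewrite mxE.
apply: cvgM; first exact: cvg_cst.
apply: cvg_det; apply/cvg_mxP => a b; rewrite !mxE; under eq_fun do rewrite !mxE.
exact: (cvg_mxP _ _).2 fL _ _.
Qed.

(** * Exact reachability in prescribed time *)

Section ExactReachability.
Variables (R : realType) (n m : nat) (A : 'M[R]_n) (B : 'M[R]_(n, m)).
Hypotheses (n_gt0 : (0 < n)%N) (kalAB : kalman_rank_condition A B).

Lemma reachable_natmul (t : R) (Y : 'M[R]_n) (k : nat) :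
  reachable A B t Y -> exists Z, reachable A B (t *+ k.+1) Z.
Proof.
move=> tY; elim: k => [|k [Z kZ]]; first by exists Y.
by exists (Y *m Z); rewrite mulrS; exact: reachableM.
Qed.

(** Small-time limits come with an uncontrolled time [t]. A fixed path to [P] fills the time [T];
    its last arc is shortened by [t] and followed by some [W] near [X P^-1]. As [t] tends to 0 the
    endpoint tends to [X]. *)
Lemma reachable_dense (T : R) (X : 'M[R]_n) :
  0 < T -> 0 < \det X -> closure [set Z | reachable A B T Z] X.
Proof.
move=> T_gt0 X_gt0.
have [|Y [U [YU Y0 _ _]]] :=
  @poly_trajectory_through R n m A B n 0 0 1%:M 0 n_gt0 kalAB _.
  by rewrite expr0 oner_neq0.
have [e e_gt0 eY] : exists2 e, 0 < e &
    forall t, 0 < t < e -> poly_reachable A B t (evalmx t Y).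
  have [e /= e_gt0 eP] := near_initial_reachable YU Y0.
  exists e => // t /andP[t0 te]; apply: eP => //=.
  by rewrite sub0r normrN gtr0_norm.
pose k := Num.truncn (T / e).
(* The divisor exceeds [T / e], so [s < e] and [Y] is admissible for time [s]. One arc is to be
   shortened, the other [k.+1] stay whole. *)
pose s := T / k.+2%:R.
have s_gt0 : 0 < s by rewrite divr_gt0.
have se : s < e.
  rewrite /s ltr_pdivrMr // mulrC -ltr_pdivrMr //.
  by rewrite (lt_trans (truncnS_gt _)) // ltr_nat.
have TE : T = s + s *+ k.+1.
  by rewrite -mulrS -mulr_natr mulfVK // pnatr_eq0.
have sY : reachable A B s (evalmx s Y).
  by apply: reachable_poly => //; apply: eY; rewrite s_gt0.
have [Z sZ] := reachable_natmul k sY.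
pose P := evalmx s Y *m Z.
have P_gt0 : 0 < \det P.
  by rewrite det_mulmx mulr_gt0 ?(reachable_det_gt0 sY) ?(reachable_det_gt0 sZ).
have uP : P \in unitmx by rewrite unitmxE unitfE gt_eqF.
have GX : small_time_limit A B (X *m invmx P).
  apply: small_time_limit_GLplus => //.
  by rewrite det_mulmx det_inv mulr_gt0 ?invr_gt0.
move=> N NX.
have : (p.1 *m (evalmx (s - p.2) Y *m Z) : 'M[R]_n)
    @[p --> (X *m invmx P, 0 : R)] --> X *m invmx P *m (evalmx (s - 0) Y *m Z).
  apply: cvg_mulmx; first exact: cvg_fst.
  apply: cvg_mulmx; last exact: cvg_cst.
  by apply: cvg_evalmx; apply: cvgB; [exact: cvg_cst|exact: cvg_snd].
rewrite subr0 -/P mulmxKV // => /(_ _ NX)[[Q1 Q2] /= [Q1X [d /= d_gt0 dQ2]] QN].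
have [|W [[t t_lt tW] Q1W]] := GX (Num.min d s) _ _ Q1X.
  by rewrite lt_min d_gt0.
move: t_lt; rewrite lt_min => /andP[td ts].
have t_gt0 := reachable_gt0 tW.
exists (W *m (evalmx (s - t) Y *m Z)); split; last first.
  apply: (QN (W, t)); split => //; apply: dQ2 => /=.
  by rewrite sub0r normrN gtr0_norm.
rewrite /= TE -[s in s + _](subrK t) [s - t + t]addrC -addrA.
apply: reachableM => //; apply: reachableM => //.
apply: reachable_poly; first by rewrite subr_gt0.
by apply: eY; rewrite subr_gt0 ts /=; lra.
Qed.

(** A whole neighbourhood of [Y1] is reached in time [e]. If [V'], reached in time [T - e], is close
    to [Y1^-1 X], then [X V'^-1] lies in that neighbourhood and serves as the last arc. *)
Lemma reachable_GLplus (T : R) (X : 'M[R]_n) :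
  0 < T -> 0 < \det X -> reachable A B T X.
Proof.
move=> T_gt0 X_gt0.
have [|Y [U [YU Y0 _ _]]] :=
  @poly_trajectory_through R n m A B n 0 0 1%:M 0 n_gt0 kalAB _.
  by rewrite expr0 oner_neq0.
have [e /andP[e_gt0 eT] eY] : exists2 e, 0 < e < T &
    poly_reachable A B e (evalmx e Y).
  near (0 : R)^'+ => e; exists e; last first.
    by near: e; exact: near_initial_reachable YU Y0.
  by apply/andP; split => //.
set Y1 := evalmx e Y in eY.
have Y1_gt0 := reachable_det_gt0 (reachable_poly e_gt0 eY).
have uY1 : Y1 \in unitmx by rewrite unitmxE unitfE gt_eqF.
have uX : X \in unitmx by rewrite unitmxE unitfE gt_eqF.
pose V := invmx Y1 *m X.
have V_gt0 : 0 < \det V by rewrite det_mulmx det_inv mulr_gt0 ?invr_gt0.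
have invV : X *m ((\det V')^-1 *: \adj V') @[V' --> V] --> Y1.
  have -> : Y1 = X *m invmx V.
    have uV : V \in unitmx by rewrite unitmxE unitfE gt_eqF.
    by apply: (can_inj (mulmxK uV)); rewrite mulmxKV // mulKVmx.
  apply: (@cvg_mulmx _ _ (nbhs V) _ _ _ _ (fun=> X)); first exact: cvg_cst.
  by apply: (@cvg_invmx _ _ (nbhs V) _ _ id); [exact: cvg_id|rewrite gt_eqF].
have Te : 0 < T - e by rewrite subr_gt0.
have [V' [TV' /= nV']] := reachable_dense Te V_gt0
  (invV _ (near_poly_reachable n_gt0 kalAB e_gt0 eY)).
have uV' : V' \in unitmx by rewrite unitmxE unitfE gt_eqF // (reachable_det_gt0 TV').
rewrite -[T](subrKC e).
have -> : X = X *m ((\det V')^-1 *: \adj V') *m V'.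
  by have := mulmxKV uV' X; rewrite {1}/invmx uV'.
exact: reachable_step.
Unshelve. all: by end_near.
Qed.
End ExactReachability.

(** * Caratheodory solutions *)

Section Concatenation.
Variables (R : realType).
Local Notation mu := (@lebesgue_measure R).

Lemma lipschitz_absolutely_continuous_on (V : normedModType R) (a b L : R)
    (f : R -> V) :
  (forall u v, a <= u -> u <= v -> v <= b -> `|f v - f u| <= L * (v - u)) ->
  absolutely_continuous_on a b f.
Proof.
move=> fL e e_gt0; pose L' := `|L| + 1.
have L'_gt0 : 0 < L' by rewrite ltr_wpDl.
exists (e / L'); first by rewrite divr_gt0.
move=> N u v uv _ uv_lt.
apply: (@le_lt_trans _ _ (\sum_(i < N) L' * (v i - u i))).
  apply: ler_sum => i _; have [aui [uvi vib]] := uv i.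
  rewrite (le_trans (fL _ _ aui uvi vib)) // ler_wpM2r ?subr_ge0 //.
  by rewrite (le_trans (ler_norm L)) // lerDl.
by rewrite -mulr_sumr mulrC -ltr_pdivlMr.
Qed.

(** Every interval is cut at [b] by [Num.min] and [Num.max]; for an interval on one side of [b] the
    other piece is empty, which the definition allows. *)
Lemma absolutely_continuous_on_cat (V : normedModType R) (a b c : R)
    (f g : R -> V) : a <= b -> b <= c -> f b = g b ->
  absolutely_continuous_on a b f -> absolutely_continuous_on b c g ->
  absolutely_continuous_on a c (fun t => if t <= b then f t else g t).
Proof.
move=> ab bc fgb fac gac e e_gt0; have e2 : 0 < e / 2 by rewrite divr_gt0.
have [d1 d1_gt0 fd] := fac _ e2; have [d2 d2_gt0 gd] := gac _ e2.
exists (Num.min d1 d2); first by rewrite lt_min d1_gt0.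
move=> N u v uv disj; rewrite lt_min => /andP[uv1 uv2].
pose h t := if t <= b then f t else g t.
have hE i : h (v i) - h (u i) =
    (f (Num.min (v i) b) - f (Num.min (u i) b)) +
    (g (Num.max (v i) b) - g (Num.max (u i) b)).
  have [_ [uvi _]] := uv i; rewrite /h.
  have [vb|bv] := leP (v i) b; have [ub|bu] := leP (u i) b => //.
  - by rewrite subrr addr0.
  - by have := lt_le_trans bu uvi; rewrite ltNge vb.
  - by rewrite fgb [RHS]addrC addrA subrK.
  - by rewrite subrr add0r.
have sub i t : (Num.min (u i) b < t < Num.min (v i) b) ||
    (Num.max (u i) b < t < Num.max (v i) b) -> u i < t < v i.
  by move=> /orP[]; [rewrite gt_min lt_min|rewrite gt_max lt_max]; lra.
rewrite (splitr e); apply: (@le_lt_trans _ _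
  (\sum_(i < N) `|f (Num.min (v i) b) - f (Num.min (u i) b)| +
   \sum_(i < N) `|g (Num.max (v i) b) - g (Num.max (u i) b)|)).
  rewrite -big_split /=; apply: ler_sum => i _.
  by rewrite -/(h _) -/(h _) hE ler_normD.
apply: ltrD.
- apply: fd.
  + move=> i; have [aui [uvi vci]] := uv i.
    by rewrite le_min aui ab le_min !ge_min uvi lexx !orbT.
  + move=> i j _ _ [t /= [ti tj]]; apply: disj => //; exists t => /=.
    rewrite !in_itv /= in ti tj *.
    by split; apply: sub; rewrite ?ti ?tj.
  + apply: le_lt_trans uv1; apply: ler_sum => i _.
    have [aui [uvi vci]] := uv i.
    by case: (leP (v i) b); case: (leP (u i) b); lra.
- apply: gd.
  + move=> i; have [aui [uvi vci]] := uv i.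
    by rewrite !ge_max !le_max vci bc uvi lexx !orbT.
  + move=> i j _ _ [t /= [ti tj]]; apply: disj => //; exists t => /=.
    rewrite !in_itv /= in ti tj *.
    by split; apply: sub; rewrite ?ti ?tj orbT.
  + apply: le_lt_trans uv2; apply: ler_sum => i _.
    have [aui [uvi vci]] := uv i.
    by case: (leP (v i) b); case: (leP (u i) b); lra.
Qed.

Lemma integrable_cat (a b c : R) (f g : R -> R) : a <= b -> b <= c ->
  mu.-integrable `[a, b] (EFin \o f) -> mu.-integrable `[b, c] (EFin \o g) ->
  mu.-integrable `[a, c] (fun t => (if t <= b then f t else g t)%:E).
Proof.
move=> ab bc fi gi.
have restr (I : interval R) (h : R -> R) : mu.-integrable [set` I] (EFin \o h) ->
    mu.-integrable setT ((EFin \o h) \_ [set` I]).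
  exact: (@integrable_mkcond _ _ _ mu _ (EFin \o h) (measurable_itv I)).1.
(* Dropping [b] makes the supports of the two extensions by zero disjoint, so their sum is the glued
   function. *)
have {}gi : mu.-integrable `]b, c] (EFin \o g).
  apply: integrableS gi; try exact: measurable_itv.
  by apply: subset_itv; rewrite bnd_simp.
have fgi := integrableD measurableT (restr _ _ fi) (restr _ _ gi).
have mac : measurable (`[a, c]%classic : set (measurableTypeR R)).
  exact: measurable_itv.
apply: (eq_integrable mac _ _ _ (integrableS measurableT mac (@subsetT _ _) fgi)).
move=> t; rewrite inE /= in_itv /= => /andP[at_ tc].
rewrite !patchE !mem_setE !in_itv /= at_ tc andbT /=.
by rewrite leNgt; case: ltP; rewrite ?add0e ?adde0.
Qed.

End Concatenation.

Lemma is_derive_mx (R : realType) (m n : nat) (f : R -> 'M[R]_(m, n)) (t : R)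
    (D : 'M[R]_(m, n)) :
  (forall i j, is_derive t (1 : R) (fun x => f x i j) (D i j)) <->
  is_derive t (1 : R) f D.
Proof.
split=> [fD|[df <-] i j].
  have df : derivable f t 1 by apply/derivable_mxP => i j; case: (fD i j).
  apply: DeriveDef => //; rewrite derive_mx //; apply/matrixP => i j.
  by rewrite mxE; case: (fD i j).
by rewrite derive_mx // mxE; apply: derivableP; move/derivable_mxP: df; apply.
Qed.

(** * Polynomial arcs as Caratheodory solutions *)

Section Steering.
Variables (R : realType) (n m : nat) (A : 'M[R]_n) (B : 'M[R]_(n, m)).
Local Notation mu := (@lebesgue_measure R).

Definition solution_on (a b : R) (K : R -> 'M[R]_(m, n)) (Phi : R -> 'M[R]_n) :
    Prop :=
  [/\ forall i j, mu.-integrable `[a, b] (fun t => (K t i j)%:E),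
      forall t, a <= t <= b -> GLplus (Phi t),
      absolutely_continuous_on a b Phi &
      {ae mu, forall t : R, a < t < b ->
        is_derive t (1 : R) Phi ((A + B *m K t) *m Phi t)}].

Lemma solution_on_cat (a b c : R) K1 K2 Phi1 Phi2 :
  a <= b -> b <= c -> Phi1 b = Phi2 b ->
  solution_on a b K1 Phi1 -> solution_on b c K2 Phi2 ->
  solution_on a c (fun t => if t <= b then K1 t else K2 t)
    (fun t => if t <= b then Phi1 t else Phi2 t).
Proof.
move=> ab bc Phib [K1i Phi1pos Phi1ac Phi1d] [K2i Phi2pos Phi2ac Phi2d]; split.
- move=> i j; have := integrable_cat ab bc (K1i i j) (K2i i j).
  by congr (_.-integrable _ _); apply/funext => t; case: ifP.
- move=> t /andP[at_ tc]; case: ifPn => [tb|]; first by apply: Phi1pos; rewrite at_.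
  by rewrite -ltNge => /ltW bt; apply: Phi2pos; rewrite bt.
- exact: absolutely_continuous_on_cat.
(* The glued path may have a corner at [b], a null set. *)
have nb : {ae mu, forall t, t != b}.
  exists [set b]; split; [exact: measurable_set1|exact: lebesgue_measure_set1|].
  by move=> t /= /negP/negPn/eqP.
have ae_mu : Filter (almost_everywhere mu) by exact: ae_filter_ringOfSetsType.
apply: filterS3 nb Phi1d Phi2d => t tb d1 d2 /andP[at_ tc].
have [t_le_b|b_lt_t] := leP t b.
  have {}tb : t < b by rewrite lt_neqAle tb.
  apply: near_eq_is_derive (d1 _); last by rewrite at_.
  by near=> s; rewrite ifT //; apply: ltW; near: s; exact: lt_nbhsl.
apply: near_eq_is_derive (d2 _); last by rewrite b_lt_t.
by near=> s; rewrite ifN // -ltNge; near: s; exact: lt_nbhsr.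
Unshelve. all: by end_near.
Qed.

(** The bound on the values accompanies the Lipschitz bound because the Horner step estimates the
    increment of a product. *)
Lemma poly_lipschitz (p : {poly R}) (a b : R) :
  exists2 L : R * R, 0 <= L.1 /\ 0 <= L.2 &
    forall u v, a <= u <= b -> a <= v <= b ->
      `|p.[u]| <= L.1 /\ `|p.[v] - p.[u]| <= L.2 * `|v - u|.
Proof.
elim/poly_ind: p => [|p c [[M L] [/= M0 L0] pML]].
  by exists (0, 0) => // u v _ _; rewrite !horner0 subrr normr0 mul0r.
pose r := `|a| + `|b|.
have r0 : 0 <= r by rewrite addr_ge0.
exists (M * r + `|c|, L * r + M) => [|u v uab vab].
  by split; rewrite addr_ge0 // mulr_ge0.
have ur : `|u| <= r.
  rewrite ler_norml /r; have := ler_norm b; have := ler_norm (- a).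
  by rewrite normrN; have := normr_ge0 a; have := normr_ge0 b; lra.
have [pM pL] := pML u v uab vab.
rewrite !hornerMXaddC; split.
  by rewrite (le_trans (ler_normD _ _)) // lerD2r normrM ler_pM.
have -> : p.[v] * v + c - (p.[u] * u + c) = (p.[v] - p.[u]) * u + p.[v] * (v - u).
  by ring.
have [pMv _] := pML v u vab uab.
rewrite (le_trans (ler_normD _ _)) // !normrM mulrDl lerD ?ler_wpM2r //.
by rewrite mulrAC ler_pM.
Qed.

Lemma mx_norm_ler (p q : nat) (M : 'M[R]_(p, q)) (e : R) :
  0 <= e -> (forall i j, `|M i j| <= e) -> `|M| <= e.
Proof.
move=> e_ge0 Me; rewrite /Num.Def.normr /= mx_normrE.
by apply: bigmax_le => // -[i j] _; exact: Me.
Qed.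

Lemma evalmx_lipschitz (p q : nat) (X : 'M[{poly R}]_(p, q)) (a b : R) :
  exists L : R, forall u v, a <= u <= b -> a <= v <= b ->
    `|evalmx v X - evalmx u X| <= L * `|v - u|.
Proof.
have /choice[L LP] : forall ij : 'I_p * 'I_q, exists l : R, 0 <= l /\
    forall u v, a <= u <= b -> a <= v <= b ->
    `|(X ij.1 ij.2).[v] - (X ij.1 ij.2).[u]| <= l * `|v - u|.
  move=> ij; have [[M L] /= [_ L0] ML] := poly_lipschitz (X ij.1 ij.2) a b.
  by exists L; split=> // u v uab vab; have [_] := ML u v uab vab.
exists (\sum_ij L ij) => u v uab vab.
have sumL0 : 0 <= \sum_ij L ij by apply: sumr_ge0 => ij _; have [] := LP ij.
apply: mx_norm_ler => [|i j]; first by rewrite mulr_ge0.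
rewrite !mxE /= /horner_eval.
have [_ /(_ u v uab vab) /le_trans-> //] := LP (i, j).
rewrite ler_wpM2r // (bigD1 (i, j)) //= lerDl.
by apply: sumr_ge0 => ij _; have [] := LP ij.
Qed.

(** The control is [U X^-1], continuous where the determinant is positive, hence integrable on the
    compact interval. *)
Lemma solution_on_poly (a b : R) (X : 'M[{poly R}]_n) (U : 'M[{poly R}]_(m, n)) :
  poly_trajectory A B X U ->
  (forall t, a <= t <= b -> 0 < \det (evalmx (t - a) X)) ->
  solution_on a b
    (fun t => evalmx (t - a) U *m
       ((\det (evalmx (t - a) X))^-1 *: \adj (evalmx (t - a) X)))
    (fun t => evalmx (t - a) X).
Proof.
move=> XU Xpos; split=> //.
- move=> i j; apply: (@continuous_compact_integrable R
    (fun t => (evalmx (t - a) U *m _) i j) _ (@segment_compact R a b)).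
  apply: continuous_in_subspaceT => t; rewrite inE /= in_itv /= => tab.
  have ta : (s - a : R) @[s --> t] --> t - a.
    by apply: cvgB; [exact: cvg_id|exact: cvg_cst].
  have dX : \det (evalmx (t - a) X) != 0 by rewrite gt_eqF ?Xpos.
  have tE : (\det (evalmx (t - a) X))^-1 *: \adj (evalmx (t - a) X) =
      invmx (evalmx (t - a) X) by rewrite /invmx unitmxE unitfE dX.
  rewrite /continuous_at tE.
  apply: (cvg_mxP _ _).2; apply: (@cvg_mulmx _ _ (nbhs t)).
    exact: cvg_evalmx ta.
  by apply: (@cvg_invmx _ _ (nbhs t)) => //; exact: cvg_evalmx ta.
- have [L XL] := evalmx_lipschitz X 0 (b - a).
  apply: (@lipschitz_absolutely_continuous_on _ _ _ _ L) => u v au uv vb.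
  rewrite (le_trans (XL _ _ _ _)) ?subr_ge0 ?lerB ?au ?(le_trans au uv) //=.
    by rewrite (le_trans uv vb).
  by rewrite opprB addrA subrK ger0_norm // subr_ge0.
have ae_mu : Filter (almost_everywhere mu) by exact: ae_filter_ringOfSetsType.
apply: filterE => t /andP[at_ tb].
set Xt := evalmx (t - a) X.
have uX : Xt \in unitmx by rewrite unitmxE unitfE gt_eqF // Xpos // !ltW.
have -> : (A + B *m (evalmx (t - a) U *m ((\det Xt)^-1 *: \adj Xt))) *m Xt =
    evalmx (t - a) (map_mx (@deriv R) X).
  rewrite XU map_mxD !map_mxM !horner_eval_mxC mulmxDl -!mulmxA.
  by have := mulVmx uX; rewrite {1}/invmx uX => ->; rewrite mulmx1.
apply/is_derive_mx => i j; rewrite !mxE.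
have -> : (fun x => evalmx (x - a) X i j) = horner (X i j \Po ('X - a%:P)).
  by apply/funext => x; rewrite mxE horner_comp hornerXsubC.
apply: is_derive_eq; rewrite deriv_comp derivXsubC mulr1 horner_comp.
by rewrite hornerXsubC.
Qed.

Lemma reachable_solution (T : R) (X : 'M[R]_n) : reachable A B T X ->
  exists K Phi, [/\ solution_on 0 T K Phi, Phi 0 = 1%:M & Phi T = X].
Proof.
elim=> [{}T Y T_gt0 [X' [U [XU X0 XT Xpos]]]|].
  have := @solution_on_poly 0 T X' U XU.
  move=> sol; do 2 eexists; split; first apply: sol => t t0T.
  - by rewrite subr0; exact: Xpos.
  - by rewrite /= subr0.
  - by rewrite /= subr0.
move=> S {}T Y Z S_gt0 [X' [U [XU X0 XS Xpos]]] TZ [K [Phi [sol Phi0 PhiT]]].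
have T_gt0 := reachable_gt0 TZ; have Z_gt0 := reachable_det_gt0 TZ.
have WE t : evalmx t (X' *m constmx Z) = evalmx t X' *m Z.
  by rewrite map_mxM horner_eval_mxC.
have sol2 := @solution_on_poly T (S + T) (X' *m constmx Z) (U *m constmx Z)
  (poly_trajectoryMr Z XU).
do 2 eexists; split.
- apply: solution_on_cat sol (sol2 _) => //.
  + exact: ltW.
  + by rewrite lerDr ltW.
  + by rewrite /= PhiT subrr WE X0 mul1mx.
  + move=> t /andP[Tt tS]; rewrite WE det_mulmx mulr_gt0 // Xpos //.
    by rewrite subr_ge0 Tt lerBlDr.
- by rewrite /= ltW.
- by rewrite /= leNgt ltrDr S_gt0 /= addrK WE XS.
Qed.

Lemma kalman_strongly_controllable : (0 < n)%N -> kalman_rank_condition A B ->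
  strongly_controllable A B.
Proof.
move=> n_gt0 kalAB T T_gt0 X X_gt0.
have [K [Phi [[Ki Phipos Phiac Phid] Phi0 PhiT]]] :=
  reachable_solution (reachable_GLplus n_gt0 kalAB T_gt0 X_gt0).
by exists K; split => //; exists Phi.
Qed.
End Steering.

(** * Uniqueness for absolutely continuous functions *)

(** At the supremum of the points satisfying [P], a step ending there shows that it is attained, and
    a step starting there passes beyond it unless it is [b]. Only steps with [t] as an endpoint are
    required, since a derivative at [t] controls only those. *)
Lemma real_induction (R : realType) (P : R -> Prop) (a b : R) :
  a <= b -> P a ->
  (forall t, a <= t <= b -> exists2 d, 0 < d & forall x y,
     a <= x -> x <= y -> y <= b -> x = t \/ y = t -> y - x < d -> P x -> P y) ->
  P b.
Proof.
move=> ab Pa step; pose S := [set x | a <= x <= b /\ P x].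
have Sa : S a by rewrite /S /= lexx ab.
have supS : has_sup S by split; [exists a|exists b => x [/andP[]]].
set s := sup S.
have as_ : a <= s by apply: sup_ubound => //; case: supS.
have sb : s <= b by apply: ge_sup => [|x [/andP[]]//]; case: supS.
have [|d d_gt0 dP] := step s; first by rewrite as_.
have Ps : P s.
  have [x [/andP[ax xb] Px] sdx] := sup_adherent d_gt0 supS.
  have xs : x <= s by apply: sup_ubound; [case: supS|rewrite /S /= ax xb].
  apply: (dP x) => //; first by right.
  by rewrite ltrBlDr -ltrBlDl.
move: sb; rewrite le_eqVlt => /predU1P[<- //|sb].
pose y := Num.min b (s + d / 2).
have d2 : 0 < d / 2 by rewrite divr_gt0.
have sy : s < y by rewrite lt_min sb ltrDl.
have Sy : S y.
  split; first by rewrite (le_trans as_ (ltW sy)) /y ge_min lexx.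
  apply: (dP s) => //; [exact: ltW|by rewrite /y ge_min lexx|by left|].
  rewrite ltrBlDl /y gt_min; apply/orP; right; rewrite ltrD2l.
  by rewrite ltr_pdivrMr // mulr_natr mulr2n ltrDl.
have : y <= s by apply: sup_ubound => //; case: supS.
by rewrite leNgt sy.
Qed.

Lemma is_derive_mulmx (R : realType) (m n p q : nat) (M : 'M[R]_(m, n))
    (f : R -> 'M[R]_(n, p)) (N : 'M[R]_(p, q)) (t : R) (D : 'M[R]_(n, p)) :
  is_derive t (1 : R) f D ->
  is_derive t (1 : R) (fun x => M *m f x *m N) (M *m D *m N).
Proof.
move=> [df fD].
have MfN : h^-1 *: (M *m f (h *: 1 + t) *m N - M *m f t *m N) @[h --> 0^'] -->
    M *m D *m N.
  have -> : (fun h : R => h^-1 *: (M *m f (h *: 1 + t) *m N - M *m f t *m N)) =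
      (fun h => M *m (h^-1 *: (f (h *: 1 + t) - f t)) *m N).
    by apply/funext => h; rewrite -scalemxAr -scalemxAl mulmxBr mulmxBl.
  apply: cvg_mulmx; last exact: cvg_cst.
  by apply: cvg_mulmx; [exact: cvg_cst|rewrite -fD; exact: df].
by apply: DeriveDef; [apply/cvg_ex; eexists; exact: MfN|exact: cvg_lim MfN].
Qed.

Lemma norm_mulmx (R : realType) (m n p : nat) (M : 'M[R]_(m, n)) (N : 'M[R]_(n, p)) :
  `|M *m N| <= n%:R * `|M| * `|N|.
Proof.
have entry k l (X : 'M[R]_(k, l)) i j : `|X i j| <= `|X|.
  by rewrite [leRHS]/Num.Def.normr /= mx_normrE; exact: (le_bigmax _ _ (i, j)).
apply: mx_norm_ler => [|i j]; first by rewrite !mulr_ge0.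
rewrite mxE (le_trans (ler_norm_sum _ _ _)) //.
rewrite (le_trans (ler_sum _ (fun k _ => _ : _ <= `|M| * `|N|))) //.
  by move=> k; rewrite normrM ler_pM.
by rewrite sumr_const card_ord -mulrA mulr_natl.
Qed.

(** * A Gronwall estimate with an exceptional null set *)

Section Gronwall.
Variables (R : realType) (V : normedModType R).
Local Notation mu := (@lebesgue_measure R).

Lemma null_set_open_cover (N : set R) (d : R) : mu.-negligible N -> 0 < d ->
  exists U : set R, [/\ open U, N `<=` U & (mu U < d%:E)%E].
Proof.
move=> [E [mE E0 NE]] d_gt0.
have muE : (mu E < +oo)%E by rewrite E0.
have [U [oU EU UE]] := lebesgue_regularity_outer mE muE d_gt0.
exists U; split => //; first exact: subset_trans EU.
have mU : measurable U by exact: open_measurable.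
have : mu U = (mu E + mu (U `\` E))%E.
  rewrite -measureU //; [by rewrite setDUK| exact: measurableD|].
  by rewrite setDE setICA setICr setI0.
by rewrite E0 add0e => ->.
Qed.

Lemma is_derive_near (f : R -> V) (t : R) (l : V) (e : R) : 0 < e ->
  is_derive t (1 : R) f l ->
  exists2 d, 0 < d & forall x, `|x - t| < d ->
    `|f x - f t| <= (`|l| + e) * `|x - t|.
Proof.
move=> e_gt0 [df fl].
have : h^-1 *: (f (h *: 1 + t) - f t) @[h --> 0^'] --> l by rewrite -fl; exact: df.
move=> /cvgrPdist_lt/(_ _ e_gt0)[d /= d_gt0 dP].
exists d => // x xt; have [->|x_neq_t] := eqVneq x t.
  by rewrite !subrr !normr0 mulr0.
have h_neq0 : x - t != 0 by rewrite subr_eq0.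
have := dP (x - t); rewrite /= sub0r normrN => /(_ xt h_neq0).
rewrite (_ : (x - t) *: 1 + t = x); last by rewrite /GRing.scale /= mulr1 subrK.
set q := _ *: _ => lq; have -> : f x - f t = (x - t) *: q.
  by rewrite /q scalerA divff // scale1r.
rewrite normrZ mulrC ler_wpM2r //.
by rewrite -lerBlDl (le_trans (lerB_dist _ _)) // distrC ltW.
Qed.

(* The intervals are those of a subdivision of [a, x] on which no bound on the
   derivative is available; they lie in an open cover [U] of the exceptional null
   set, and only their total length is recorded. *)
Definition bad_sum (f : R -> V) (U : set R) (a x z : R) : Prop :=
  exists (N : nat) (u v : 'I_N -> R),
    [/\ forall i, a <= u i /\ u i <= v i /\ v i <= x,
        trivIset [set: 'I_N] (fun i => `]u i, v i[%classic),
        ((\sum_(i < N) (v i - u i))%:E <= mu (U `&` `[a, x[))%E &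
        z = \sum_(i < N) `|f (v i) - f (u i)|].

Lemma bad_sum_nil (f : R -> V) (U : set R) (a : R) : bad_sum f U a a 0.
Proof.
exists 0%N, (fun=> 0), (fun=> 0); split; [by case| by move=> [] | |].
  by rewrite big_ord0; exact: measure_ge0.
by rewrite big_ord0.
Qed.

Lemma bad_sum_weaken (f : R -> V) (U : set R) (a x y z : R) : measurable U ->
  x <= y -> bad_sum f U a x z -> bad_sum f U a y z.
Proof.
move=> mU xy [N [u [v [uv disj len ->]]]]; exists N, u, v; split => //.
  by move=> i; have [? [? ?]] := uv i; do 2!split => //; exact: le_trans xy.
apply: le_trans len _; apply: le_measure; rewrite ?inE.
- by apply: measurableI => //; exact: measurable_itv.
- by apply: measurableI => //; exact: measurable_itv.
- by apply: setIS; apply: subset_itvl; rewrite bnd_simp.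
Qed.

Lemma bad_sum_rcons (f : R -> V) (U : set R) (a x y z : R) : measurable U ->
  a <= x -> x <= y -> `[x, y] `<=` U -> bad_sum f U a x z ->
  bad_sum f U a y (z + `|f y - f x|).
Proof.
move=> mU ax xy xyU [N [u [v [uv disj len ->]]]].
pose ext (w : 'I_N -> R) c (i : 'I_N.+1) := oapp w c (unlift ord_max i).
have extS w c (i : 'I_N) : ext w c (widen_ord (leqnSn N) i) = w i.
  rewrite /ext (_ : widen_ord _ i = lift ord_max i) ?liftK //.
  by apply/val_inj; rewrite /= /bump leqNgt ltn_ord.
have extM w c : ext w c ord_max = c by rewrite /ext unlift_none.
have ord_cases (i : 'I_N.+1) :
    (exists j : 'I_N, i = widen_ord (leqnSn N) j) \/ i = ord_max.
  have [iN|Ni] := ltnP i N; [left; exists (Ordinal iN)|right]; apply/val_inj => //=.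
  by apply/eqP; rewrite eqn_leq Ni -ltnS ltn_ord.
exists N.+1, (ext u x), (ext v y); split.
- move=> i; have [[j ->]|->] := ord_cases i; rewrite !(extS, extM) //.
  by have [? [? vx]] := uv j; do 2!split => //; exact: le_trans xy.
- move=> i j _ _ [t [/=]]; rewrite !in_itv /=.
  have [[i' ->]|->] := ord_cases i; have [[j' ->]|->] := ord_cases j;
    rewrite !(extS, extM) //.
  + move=> ti tj; congr widen_ord; apply: disj => //.
    by exists t; rewrite /= !in_itv.
  + move=> /andP[_ tv] /andP[xt _]; have [_ [_ vx]] := uv i'.
    by have := lt_trans xt (lt_le_trans tv vx); rewrite ltxx.
  + move=> /andP[xt _] /andP[_ tv]; have [_ [_ vx]] := uv j'.
    by have := lt_trans xt (lt_le_trans tv vx); rewrite ltxx.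
- rewrite big_ord_recr /= !extM; under eq_bigr do rewrite !extS.
  (* Half-open intervals make the old and the new part disjoint, so their measures add. *)
  have -> : U `&` `[a, y[ = (U `&` `[a, x[) `|` `[x, y[.
    apply/seteqP; split=> w /=; rewrite !in_itv /=.
      by move=> [Uw /andP[aw wy]]; case: (ltP w x) => xw; [left|right]; rewrite ?aw.
    move=> [[Uw /andP[aw wx]]|/andP[xw wy]]; first by rewrite aw (lt_le_trans wx).
    by rewrite wy (le_trans ax xw); split => //; apply: xyU; rewrite /= in_itv /= xw ltW.
  rewrite measureU ?EFinD; last 3 first.
  + by apply: measurableI => //; exact: measurable_itv.
  + exact: measurable_itv.
  + apply/seteqP; split=> // w [[_ /=]]; rewrite !in_itv /= => /andP[_ wx] /andP[xw _].
    by have := lt_le_trans wx xw; rewrite ltxx.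
  apply: leeD; first exact: len.
  rewrite [leRHS]lebesgue_measure_itv /= lte_fin; case: ltP => //.
  by rewrite lee_fin subr_le0.
- by rewrite big_ord_recr /= !extM; under [in RHS]eq_bigr do rewrite !extS.
Qed.

(** The slope bound may come from the right endpoint, so that [q] occurs on both sides. The bound on
    [h] gives [(1 - L h) (1 + 2 L h) >= 1], whence the doubled constants. *)
Lemma growth_step (L e h p q : R) : 0 <= L -> 0 < e -> 0 <= h ->
  h < (2 * L + 1)^-1 -> 0 <= p -> 0 <= q ->
  q <= p + (L * p + e) * h \/ q <= p + (L * q + e) * h ->
  q <= expR (2 * L * h) * p + 2 * e * h.
Proof.
move=> L_ge0 e_gt0 h_ge0; have L1 : 0 < 2 * L + 1 by rewrite ltr_wpDl // mulr_ge0.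
rewrite -div1r ltr_pdivlMr // mulrDr mulr1 => hL p_ge0 q_ge0 pq.
have Lh : 0 <= L * h by rewrite mulr_ge0.
have eh : 0 <= e * h by rewrite mulr_ge0 // ltW.
have Lhp : 0 <= L * h * p by rewrite mulr_ge0.
apply: (@le_trans _ _ ((1 + 2 * L * h) * p + 2 * e * h)); last first.
  by rewrite lerD2r ler_wpM2r // expR_ge1Dx.
case: pq => [|qq]; first by nra.
have Lh2 : 2 * (L * h) <= 1 by lra.
have : q * ((1 - L * h) * (1 + 2 * (L * h))) <= (p + e * h) * (1 + 2 * (L * h)).
  by rewrite [leLHS]mulrA ler_wpM2r //; lra.
have : q <= q * ((1 - L * h) * (1 + 2 * (L * h))).
  by rewrite ler_peMr //; nra.
have : e * h * (2 * (L * h)) <= e * h by rewrite ler_piMr.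
lra.
Qed.

(** The exceptional set is covered by an open [U] so small that absolute continuity bounds the total
    increment over steps inside [U] by [e]; the other steps obey [growth_step]. Real induction
    propagates the resulting bound, with the increments inside [U] recorded in [z]. *)
Lemma absolutely_continuous_gronwall (a b L : R) (f : R -> V) :
  a <= b -> 0 <= L -> absolutely_continuous_on a b f -> f a = 0 ->
  {ae mu, forall t : R, a < t < b ->
     exists2 l, is_derive t (1 : R) f l & `|l| <= L * `|f t|} ->
  f b = 0.
Proof.
move=> ab L_ge0 fac fa fae; apply/eqP; rewrite -normr_le0.
apply/ler_addgt0Pl => e0 e0_gt0; rewrite addr0.
(* The final bound is [e * C]: the slope errors contribute [2 * e * (b - a)] and the bad sum at most
   [e], both amplified by the exponential. *)
pose C := expR (2 * L * (b - a)) * (2 * (b - a) + 1).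
have C_gt0 : 0 < C by rewrite mulr_gt0 ?expR_gt0 // ltr_wpDl // mulr_ge0 // subr_ge0.
pose e := e0 / C; have e_gt0 : 0 < e by rewrite divr_gt0.
have [d d_gt0 dP] := fac e e_gt0.
(* The endpoints are included so that every point of [[a, b]] outside [U] is interior and has a
   derivative. *)
pose bad := ~` [set t | a < t < b ->
     exists2 l, is_derive t (1 : R) f l & `|l| <= L * `|f t|] `|`
  ([set a] `|` [set b]).
have neg_bad : mu.-negligible bad.
  apply: negligibleU; first exact: fae.
  by apply: negligibleU;
    (apply/negligibleP; [exact: measurable_set1|exact: lebesgue_measure_set1]).
have [U [oU badU Ud]] := null_set_open_cover neg_bad d_gt0.
have mU : measurable U by exact: open_measurable.
pose P x := exists2 z, bad_sum f U a x z &
  `|f x| <= expR (2 * L * (x - a)) * (2 * e * (x - a) + z).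
have [z [N [u [v [uv disj len zE]]]] fb] : P b.
  apply: (@real_induction _ P a b) => //.
    exists 0; first exact: bad_sum_nil.
    by rewrite fa normr0 mulr_ge0 ?expR_ge0 // subrr !mulr0 addr0.
  have expR_monoL x y : x <= y -> expR (2 * L * (x - a)) <= expR (2 * L * (y - a)).
    by move=> xy; rewrite ler_expR ler_wpM2l ?mulr_ge0 // lerB.
  have expR1 x : a <= x -> 1 <= expR (2 * L * (x - a)).
    by move=> ax; rewrite -expR0 ler_expR !mulr_ge0 // subr_ge0.
  have z_ge0 x z : bad_sum f U a x z -> 0 <= z.
    by move=> [N [u [v [_ _ _ ->]]]]; apply: sumr_ge0.
  move=> t /andP[at_ tb]; have [Ut|nUt] := pselect (U t).
    have [d' /= d'_gt0 d'U] : nbhs t U by exact: oU.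
    exists d' => // x y ax xy yb xyt yx [z zP fx].
    exists (z + `|f y - f x|).
      apply: bad_sum_rcons zP => // w /=; rewrite in_itv /= => /andP[xw wy].
      apply: d'U; rewrite /ball /= ltr_norml; case: xyt => <-; apply/andP; split; lra.
    have Ey := expR_monoL _ _ xy; have E1 := expR1 _ (le_trans ax xy).
    have zx : 0 <= 2 * e * (x - a) + z.
      by rewrite addr_ge0 ?(z_ge0 _ _ zP) // mulr_ge0 ?subr_ge0 // mulr_ge0 // ltW.
    rewrite -[f y in leLHS](subrK (f x)) (le_trans (ler_normD _ _)) //.
    rewrite addrC addrA mulrDr lerD //; last by rewrite ler_peMl.
    rewrite (le_trans fx) // ler_pM ?expR_ge0 // lerD2r ler_wpM2l //.
      by rewrite mulr_ge0 // ltW.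
    by rewrite lerB.
  (* Outside [U] the derivative at [t] controls the step, and [z] is unchanged. *)
  have ta : a != t by apply/eqP => tE; apply: nUt; apply: badU; right; left.
  have tb' : t != b by apply/eqP => tE; apply: nUt; apply: badU; right; right.
  have t_in : a < t < b by rewrite !lt_neqAle at_ tb ta tb'.
  have [l fl lL] : exists2 l, is_derive t (1 : R) f l & `|l| <= L * `|f t|.
    by apply: contrapT => nt; apply: nUt; apply: badU; left => /(_ t_in).
  have [d' d'_gt0 d'P] := is_derive_near e_gt0 fl.
  have L1 : 0 < 2 * L + 1 by rewrite ltr_wpDl // mulr_ge0.
  exists (Num.min d' (2 * L + 1)^-1); first by rewrite lt_min d'_gt0 invr_gt0.
  move=> x y ax xy yb xyt; rewrite lt_min => /andP[yxd yxL] [z zP fx].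
  exists z; first exact: bad_sum_weaken zP.
  have z0 := z_ge0 _ _ zP.
  have h_ge0 : 0 <= y - x by rewrite subr_ge0.
  have fy : `|f y| <= expR (2 * L * (y - x)) * `|f x| + 2 * e * (y - x).
    apply: growth_step => //; case: xyt => tE; [left|right].
      rewrite -[f y](subrK (f x)) (le_trans (ler_normD _ _)) // addrC lerD2l.
      rewrite -tE in d'P lL; have := d'P y; rewrite ger0_norm // => /(_ yxd) /le_trans.
      by apply; rewrite ler_wpM2r // lerD2r.
    rewrite -[f y in leLHS](subrK (f x)) (le_trans (ler_normD _ _)) // addrC lerD2l.
    rewrite -tE in d'P lL; have := d'P x.
    rewrite !(distrC _ y) ger0_norm // (distrC (f x)) => /(_ yxd) /le_trans.
    by apply; rewrite ler_wpM2r // lerD2r.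
  have EyE : expR (2 * L * (y - a)) = expR (2 * L * (y - x)) * expR (2 * L * (x - a)).
    by rewrite -expRD -mulrDr addrA subrK.
  rewrite (le_trans fy) // (_ : 2 * e * (y - a) + z =
    2 * e * (x - a) + z + 2 * e * (y - x)); last by ring.
  rewrite [leRHS]mulrDr lerD //; first by rewrite EyE -[leRHS]mulrA ler_wpM2l // expR_ge0.
  by rewrite ler_peMl ?expR1 ?(le_trans ax) // mulr_ge0 // mulr_ge0 // ltW.
rewrite (le_trans fb) // (_ : e0 = expR (2 * L * (b - a)) * (2 * e * (b - a) + e)).
  rewrite ler_wpM2l ?expR_ge0 // lerD2l zE ltW //; apply: dP => //.
  rewrite -lte_fin (le_lt_trans len) // (le_lt_trans _ Ud) //.
  apply: le_measure; rewrite ?inE //.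
  by apply: measurableI => //; exact: measurable_itv.
rewrite (_ : 2 * e * (b - a) + e = e * (2 * (b - a) + 1)); last by ring.
by rewrite mulrCA -/C /e divfK // gt_eqF.
Qed.
End Gronwall.

(** * The invariant subspace of the Kalman matrix *)

(** Multiplication by [A] shifts the blocks of the Kalman matrix; the last one becomes
    [A ^+ n *m B], a combination of the others by Cayley-Hamilton. *)
Lemma kalman_kermx (R : realType) (n m : nat) (A : 'M[R]_n) (B : 'M[R]_(n, m)) :
  (0 < n)%N -> let N := kermx (kalman_matrix A B) in
  N *m B = 0 /\ exists C : 'M[R]_n, N *m A = C *m N.
Proof.
move=> n_gt0 N.
have NAB k : (k < n)%N -> N *m (A ^+ k *m B) = 0.
  move=> kn; have := mulmx_ker (kalman_matrix A B).
  rewrite -/N /kalman_matrix mul_mxrow => /(congr1 (fun M => submxrow M (Ordinal kn))).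
  by rewrite mxrowK submxrow0.
split; first by have := NAB 0%N n_gt0; rewrite expr0 mul1mx.
suff : (N *m A <= N)%MS by move=> /submxP.
apply/sub_kermxP; rewrite /kalman_matrix mul_mxrow; apply/mxrowP => k.
rewrite mxrowK submxrow0; clearbody N.
have [kn|nk] := ltnP k.+1 n.
  by have := NAB _ kn; rewrite exprS !mulmxA.
have kE : k = n.-1 :> nat by have := ltn_ord k; lia.
have /eqP := sum_char_poly_mx A n_gt0; rewrite addr_eq0 => /eqP An.
rewrite -!mulmxA (mulmxA A) kE.
have -> : A *m A ^+ n.-1 = A ^+ n.
  by have := exprS A n.-1; rewrite (prednK n_gt0) => ->.
rewrite An mulNmx mulmxN mulmx_suml mulmx_sumr.
rewrite [X in - X]big1 ?oppr0 // => j _.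
by rewrite -scalemxAl -scalemxAr NAB ?scaler0 //; lia.
Qed.

(** The product [z = N Phi D] starts at [N D = 0] and satisfies [z' = C z] almost everywhere, the
    control being annihilated by [N]. *)
Lemma solution_invariant (R : realType) (n m : nat) (A : 'M[R]_n)
    (B : 'M[R]_(n, m)) (T : R) K Phi (N C D : 'M[R]_n) :
  0 < T -> bilinear_solution A B T K Phi ->
  N *m B = 0 -> N *m A = C *m N -> N *m D = 0 -> N *m Phi T *m D = 0.
Proof.
move=> T_gt0 [Phi0 _ Phiac Phid] NB NA ND.
pose z t := N *m Phi t *m D.
apply: (@absolutely_continuous_gronwall R _ 0 T (n%:R * `|C|) z).
- exact: ltW.
- exact: mulr_ge0.
- pose c := n%:R * (n%:R * `|N|) * `|D| + 1.
  have c_gt0 : 0 < c by rewrite ltr_wpDl // !mulr_ge0.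
  move=> e e_gt0; have [d d_gt0 dP] := Phiac (e / c) (divr_gt0 e_gt0 c_gt0).
  exists d => // k u v uv disj len; have := dP k u v uv disj len.
  rewrite ltr_pdivlMr // mulr_suml; apply: le_lt_trans; apply: ler_sum => i _.
  rewrite /z -mulmxBl -mulmxBr (le_trans (norm_mulmx _ _)) //.
  rewrite (@le_trans _ _ (n%:R * (n%:R * `|N| * `|Phi (v i) - Phi (u i)|) * `|D|)) //.
    by rewrite ler_wpM2r // ler_wpM2l // norm_mulmx.
  set p := `|_ - _|; rewrite [leRHS](_ : _ = n%:R * (n%:R * `|N| * p) * `|D| + p).
    by rewrite lerDl normr_ge0.
  by rewrite /c; ring.
- by rewrite /z Phi0 mulmx1.
have ae_mu : Filter (almost_everywhere (@lebesgue_measure R)).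
  exact: ae_filter_ringOfSetsType.
apply: filterS Phid => t dPhi t0T; exists (C *m z t); last exact: norm_mulmx.
have := is_derive_mulmx N D (dPhi t0T); congr (is_derive _ _ _ _).
by rewrite /z mulmxA mulmxDr mulmxA NB mul0mx addr0 NA !mulmxA.
Qed.

(** If the left kernel [N] is nonzero, so is its cokernel [D], because [N B = 0] with [B] nonzero.
    The target [1 + q r] picks a nonzero entry of [N] and one of [D], so [N X D] has a nonzero
    entry, against [solution_invariant]. *)
Lemma controllable_kalman (R : realType) (n m : nat) (A : 'M[R]_n)
    (B : 'M[R]_(n, m)) : (0 < n)%N -> B != 0 ->
  controllable A B -> kalman_rank_condition A B.
Proof.
move=> n_gt0 B_neq0 ctrl; apply/eqP; rewrite -[_ == _]/(row_free _) -kermx_eq0.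
apply/negPn/negP => N_neq0; have [NB [C NA]] := kalman_kermx A B n_gt0.
set N := kermx _ in N_neq0 NB NA.
pose D := cokermx N; have ND : N *m D = 0 by exact: mulmx_coker.
have D_neq0 : D != 0.
  apply: contra B_neq0 => /eqP D0.
  have : row_full N by rewrite -cokermx_eq0 -/D D0.
  by move=> /row_fullP[N' N'N]; rewrite -(mul1mx B) -N'N -mulmxA NB mulmx0.
have /matrix0Pn[i [j Nij]] := N_neq0; have /matrix0Pn[k [l Dkl]] := D_neq0.
pose q : 'cV[R]_n := delta_mx j 0; pose r : 'rV[R]_n := delta_mx 0 k.
have [|T [T_gt0 [K [_ [Phi [sol PhiT]]]]]] := ctrl (1%:M + q *m r).
  rewrite /GLplus /= det_rank1_update mul_delta_mx_cond.
  by rewrite mulmxnE mxE ltr_pwDl // mulrn_wge0.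
have := solution_invariant T_gt0 sol NB NA ND.
rewrite PhiT mulmxDr mulmxDl mulmx1 ND add0r.
move=> /(congr1 (fun M : 'M[R]_n => M i l)) /eqP.
rewrite mulmxA -mulmxA -rowE -colE mxE big_ord1 [col j N _ _]mxE [row k D _ _]mxE.
rewrite [X in _ == X]mxE mulf_eq0.
by rewrite (negPf Nij) (negPf Dkl).
Qed.

Theorem theorem3 (R : realType) (n m : nat) (n_ge1 : (1 <= n)%N)
    (m_ge1 : (1 <= m)%N) (A : 'M[R]_n) (B : 'M[R]_(n, m))
    (B_full_column_rank : \rank B = m) :
  [<-> kalman_rank_condition A B;
       controllable A B;
       strongly_controllable A B].
Proof.
have B_neq0 : B != 0 by rewrite -mxrank_eq0 B_full_column_rank -lt0n.
tfae.
- move=> kalAB X X_gt0; exists 1; split => //.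
  exact: kalman_strongly_controllable.
- move=> ctrl; apply: kalman_strongly_controllable => //.
  exact: controllable_kalman.
- move=> sctrl; apply: controllable_kalman => // X X_gt0; exists 1; split => //.
  exact: sctrl.
Qed.
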